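(* Let $\rho'=(1-p)|\psi\rangle\langle\psi|+p\,I/2^n$ with $|\psi\rangle$ an $n$-qubit Haar random pure state, and let $A|B$ be a bipartition of the $n$ qubits into extensive subsystems with $n_A+n_B=n$. As $n\to\infty$: (i) for any fixed $0\le p<1$, $\mathbb{E}_{\mathrm H}[\mathcal{E}_4(\rho')]\simeq\min(n_A,n_B)\ln2$; (ii) for exponential noise $p=1-2^{-\beta n}$ with fixed $0<\beta\le1/2$, $\mathbb{E}_{\mathrm H}[\mathcal{E}_4(\rho')]\gtrsim\min(n_A,n_B)\ln2-\beta n\ln2$. In particular, whenever $\beta<\min(n_A,n_B)/n$, entanglement is detected on average via $\mathbb{E}_{\mathrm H}[\mathcal{E}_4(\rho')]>0$, and the average PT negativity $\mathbb{E}_{\mathrm H}[\mathcal{E}(\rho')]$ obeys a volume law (grows at least linearly in $n$).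
   Context: $\mathbb{E}_{\mathrm H}$ is the average over Haar random $|\psi\rangle$. The subsystems are extensive: $n_A/n$ and $n_B/n$ are fixed positive fractions as $n\to\infty$. $\simeq$ and $\gtrsim$ denote equality, respectively lower bound, in the leading order in $n$ (up to $o(n)$). The partial transpose on $B$ is $(X_A\otimes Y_B)^\Gamma=X_A\otimes Y_B^T$; $\mathcal{E}(\rho)=\ln\|\rho^\Gamma\|_1$; $p_\alpha(\rho)=\mathrm{tr}((\rho^\Gamma)^\alpha)$; $\mathcal{E}_4(\rho)=\frac12\ln(p_2^3/p_4)$. *)

(* Defs.v *)
From HB Require Import structures.
From mathcomp Require Import all_boot all_order all_algebra.
From mathcomp Require Import spectral complex.
From mathcomp Require Import all_classical all_reals all_analysis.

Set Implicit Arguments.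
Unset Strict Implicit.
Unset Printing Implicit Defensive.

Import Order.TTheory GRing.Theory Num.Theory.
Import numFieldNormedType.Exports.

Local Open Scope classical_set_scope.
Local Open Scope sesquilinear_scope.
Local Open Scope complex_scope.
Local Open Scope ring_scope.

(* The Hilbert space of a finite set I of qubits is C^(2^#|I|).  Its           *)
(* computational basis is the set of bit strings {ffun I -> bool}, numbered    *)
(* by enum_rank / enum_val, so operators are matrices of size qdim I.          *)
Definition qdim (I : finType) : nat := #|{: {ffun I -> bool}}|.

Lemma qdimE (I : finType) : qdim I = (2 ^ #|I|)%N.
Proof. by rewrite /qdim card_ffun card_bool. Qed.

Section PartialTranspose.
Variables (R : realType) (I : finType).
Implicit Types (A B : {set I}) (x y : {ffun I -> bool}).

(* the bit string equal to y on B and to x off B *)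
Definition splice B x y : {ffun I -> bool} :=
  [ffun i => if i \in B then y i else x i].

Definition ptranspose B (M : 'M[R[i]]_(qdim I)) : 'M[R[i]]_(qdim I) :=
  \matrix_(j, k)
    M (enum_rank (splice B (enum_val j) (enum_val k)))
      (enum_rank (splice B (enum_val k) (enum_val j))).

Definition restr A x : {ffun {i | i \in A} -> bool} := [ffun i => x (val i)].

(* X_A (x) Y_B with B the complement of A *)
Definition tens A (X : 'M[R[i]]_(qdim {i | i \in A}))
    (Y : 'M[R[i]]_(qdim {i | i \in ~: A})) : 'M[R[i]]_(qdim I) :=
  \matrix_(j, k)
    (X (enum_rank (restr A (enum_val j))) (enum_rank (restr A (enum_val k))) *
     Y (enum_rank (restr (~: A) (enum_val j)))
       (enum_rank (restr (~: A) (enum_val k)))).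

Lemma ptranspose_tens A (X : 'M[R[i]]_(qdim {i | i \in A}))
    (Y : 'M[R[i]]_(qdim {i | i \in ~: A})) :
  ptranspose (~: A) (tens X Y) = tens X Y^T.
Proof.
have rA x y : restr A (splice (~: A) x y) = restr A x.
  by apply/ffunP => i; rewrite !ffunE inE (valP i).
have rB x y : restr (~: A) (splice (~: A) x y) = restr (~: A) y.
  by apply/ffunP => i; rewrite !ffunE (valP i).
by apply/matrixP => j k; rewrite !mxE !enum_rankK !rA !rB.
Qed.

(* The trace is real whenever M, hence its partial transpose, is Hermitian.    *)
Definition pt_moment B (alpha : nat) (M : 'M[R[i]]_(qdim I)) : R :=
  complex.Re (\tr (ptranspose B M ^+ alpha)).

Definition pt_E4 B (M : 'M[R[i]]_(qdim I)) : R :=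
  2^-1 * ln (pt_moment B 2 M ^+ 3 / pt_moment B 4 M).

(* trace of sqrt(X^* X), computed from the eigenvalues of X^* X *)
Definition trace_norm d (X : 'M[R[i]]_d) : R :=
  \sum_(j < d) Num.sqrt (complex.Re (spectral_diag (X^t* *m X) 0 j)).

Definition pt_negativity B (M : 'M[R[i]]_(qdim I)) : R :=
  ln (trace_norm (ptranspose B M)).

Definition depolarized (p : R) (v : 'cV[R[i]]_(qdim I)) : 'M[R[i]]_(qdim I) :=
  (1 - p)%:C *: (v *m v^t* ) + (p / 2 ^+ #|I|)%:C *: 1%:M.

End PartialTranspose.

Section HaarRandomState.
Variable R : realType.

(* generators of the Borel sigma-algebra of C^d seen as R^(2d) *)
Definition cvec_cylinder d : set (set 'cV[R[i]]_d) :=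
  [set S | exists (j : 'I_d) (E : set R), measurable E /\
     (S = [set v : 'cV[R[i]]_d | E (complex.Re (v j 0))] \/
      S = [set v : 'cV[R[i]]_d | E (complex.Im (v j 0))])].

Definition cvec_borel d : set (set 'cV[R[i]]_d) := <<s @cvec_cylinder d >>.

(* The law of a Haar random pure state is the unitarily invariant probability  *)
(* measure on the unit sphere of C^d.                                          *)
Definition haar_random_state (dT : measure_display) (T : measurableType dT)
    (P : probability T R) d (psi : T -> 'cV[R[i]]_d) : Prop :=
  [/\ forall t, (psi t)^t* *m psi t = 1%:M,
      forall S, cvec_borel S -> measurable (psi @^-1` S) &
      forall U : 'M[R[i]]_d, U \is unitarymx ->
        forall S, cvec_borel S ->
          P ((fun t => U *m psi t) @^-1` S) = P (psi @^-1` S)].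

End HaarRandomState.

Section LeadingOrder.
Variable R : realType.

(* u is an expectation, a priori extended-real; the equality makes it finite   *)
Definition leading_eq (u : nat -> \bar R) (v : nat -> R) : Prop :=
  exists2 e : nat -> R^o, e =o_\oo (fun n => n%:R : R^o) &
    \forall n \near \oo, u n = (v n + e n)%:E.

Definition leading_ge (u : nat -> \bar R) (v : nat -> R) : Prop :=
  exists2 e : nat -> R^o, e =o_\oo (fun n => n%:R : R^o) &
    \forall n \near \oo, ((v n + e n)%:E <= u n)%E.

End LeadingOrder.

(* Main.v *)
From HB Require Import structures.
Require Import Defs.
From mathcomp Require Import all_boot all_order all_algebra.
From mathcomp Require Import spectral complex.
From mathcomp Require Import ring lra.
From mathcomp Require Import all_classical all_reals all_analysis.
From mathcomp Require Import measurable_realfun.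

(** Let q = 1 - p, let W be the partial transpose of the pure state and P its
    subsystem purity.  Then tr W = tr W^2 = 1, tr W^4 = P^2 and |tr W^3| <= P,
    so p_2 is deterministic and p_4 lies between q^4 P^2 / 3 and 16 q^4 P^2 as
    soon as 2^-n <= q^2.  Hence E_4 equals - ln P up to a bounded error and a
    multiple of ln q.  Pointwise P >= 2^-m with m = min(n_A, n_B), and
    ln x <= x - 1 reduces the converse on average to E[P] = O(2^-m).  For this
    second moment two kinds of unitaries suffice: flipping the sign of one
    amplitude kills the terms of P with four distinct amplitudes, and mixing two
    amplitudes bounds E|psi_i|^4 by E|psi_i|^2 |psi_j|^2.  Finally the
    Cauchy-Schwarz inequality gives p_2^3 <= ||rho^Gamma||_1^2 p_4, that is, the
    negativity is at least E_4. *)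

Set Implicit Arguments.
Unset Strict Implicit.
Unset Printing Implicit Defensive.

Import Order.TTheory GRing.Theory Num.Theory.
Import numFieldNormedType.Exports.

Local Open Scope classical_set_scope.
Local Open Scope sesquilinear_scope.
Local Open Scope complex_scope.
Local Open Scope ring_scope.

(** * Traces of Hermitian matrices *)

(** A constant factor in p_4 or in E[P] shifts E_4 by O(1), far below the o(n) resolution, so rough
    constants are enough everywhere. The obstacle is p_4: W^2 factorizes into the two reduced
    states, which gives tr W^2 and tr W^4, but W^3 does not, and its trace is controlled only
    through |tr W^3| <= P. The noise adds c = p / 2^n to the diagonal. Since c <= 2^-n <= P^2 always
    holds, the condition 2^-n <= q^2 gives c <= q P, and then every noise term of p_4 is dominated
    by q^4 P^2; for q = 2^(-beta n) this condition is beta <= 1/2. The two parts of the theorem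
    differ because p_2 is only located between q^2 and 1: up to constants, E_4 lies between - ln P +
    ln q and - ln P - 2 ln q. For fixed p both corrections are bounded. For exponential noise the
    lower one is exactly the loss beta n ln 2, while the upper one is linear in n, so only a lower
    bound comes out. *)

Lemma sum_mul_sqr_le (R : realDomainType) (I : finType) (x y : I -> R) :
  (\sum_i x i * y i) ^+ 2 <= (\sum_i x i ^+ 2) * (\sum_i y i ^+ 2).
Proof.
have : 0 <= \sum_i \sum_j (x i * y j - x j * y i) ^+ 2.
  by apply: sumr_ge0 => i _; apply: sumr_ge0 => j _; exact: sqr_ge0.
(* Lagrange's identity. *)
have -> : \sum_i \sum_j (x i * y j - x j * y i) ^+ 2 =
    2 * ((\sum_i x i ^+ 2) * (\sum_i y i ^+ 2) - (\sum_i x i * y i) ^+ 2).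
  under eq_bigr => i _.
    under eq_bigr => j _.
      rewrite (_ : _ ^+ 2 = x i ^+ 2 * y j ^+ 2 + y i ^+ 2 * x j ^+ 2
        - 2 * (x i * y i) * (x j * y j)); last by ring.
      over.
    rewrite sumrB big_split /= -!mulr_sumr.
    over.
  rewrite sumrB big_split /= -!mulr_suml -mulr_sumr.
  ring.
by rewrite pmulr_rge0 // subr_ge0.
Qed.

(** Interpolation through the third power sum [e]: Cauchy-Schwarz gives b^2 <= a e and e^2 <= b c,
    hence b^4 <= a^2 b c, and one factor b cancels. *)
Lemma sum_sqr_cube_le (R : rcfType) (I : finType) (s : I -> R) :
  (forall i, 0 <= s i) ->
  (\sum_i s i ^+ 2) ^+ 3 <= (\sum_i s i) ^+ 2 * (\sum_i s i ^+ 4).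
Proof.
move=> s0.
set a := \sum_i s i; set b := \sum_i s i ^+ 2; set c := \sum_i s i ^+ 4.
pose e := \sum_i s i ^+ 3.
have a0 : 0 <= a by apply: sumr_ge0.
have b0 : 0 <= b by apply: sumr_ge0 => i _; exact: exprn_ge0.
have c0 : 0 <= c by apply: sumr_ge0 => i _; exact: exprn_ge0.
have e0 : 0 <= e by apply: sumr_ge0 => i _; exact: exprn_ge0.
have eb : e ^+ 2 <= b * c.
  have := sum_mul_sqr_le s (fun i => s i ^+ 2).
  under eq_bigr do rewrite -exprS.
  by under [X in _ <= _ * X]eq_bigr do rewrite -exprM.
have ba : b ^+ 2 <= a * e.
  (* Here s^2 is split as s^(1/2) times s^(3/2). *)
  pose r i := Num.sqrt (s i).
  have rE i : r i ^+ 2 = s i by rewrite sqr_sqrtr.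
  have := sum_mul_sqr_le r (fun i => r i ^+ 3).
  under eq_bigr do rewrite -exprS (exprM _ 2 2) rE.
  under [X in _ <= X * _]eq_bigr do rewrite rE.
  by under [X in _ <= _ * X]eq_bigr do rewrite -exprM mulnC exprM rE.
have [->|bn0] := eqVneq b 0; first by rewrite expr0n /= mulr_ge0 ?sqr_ge0.
have bp : 0 < b by rewrite lt_def bn0.
rewrite -(ler_pM2l bp) -exprS.
have : b ^+ 4 <= a ^+ 2 * e ^+ 2.
  rewrite -exprMn (exprM _ 2 2).
  by apply: lerXn2r => //; rewrite nnegrE ?exprn_ge0 ?mulr_ge0.
move/le_trans; apply; rewrite [leRHS]mulrCA; apply: ler_wpM2l => //; exact: exprn_ge0.
Qed.

Section AffineMatrixPowers.
Variables (K : comNzRingType) (d : nat) (W : 'M[K]_d) (q c : K).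

Lemma affine_mx_sqr : (q *: W + c *: 1%:M) ^+ 2 =
  q ^+ 2 *: W ^+ 2 + (2 * q * c) *: W + c ^+ 2 *: 1%:M.
Proof.
rewrite !expr2 -!mulmxE mulmxDl !mulmxDr -!scalemxAl -!scalemxAr !scalerA.
rewrite !(mulmx1, mul1mx) addrA -[_ + _ + _ *: W]addrA -scalerDl.
by congr (_ + _ *: _ + _); ring.
Qed.

Lemma affine_mx_exp4 : (q *: W + c *: 1%:M) ^+ 4 =
  q ^+ 4 *: W ^+ 4 + (4 * q ^+ 3 * c) *: W ^+ 3 +
  (6 * q ^+ 2 * c ^+ 2) *: W ^+ 2 + (4 * q * c ^+ 3) *: W + c ^+ 4 *: 1%:M.
Proof.
have W4 : W ^+ 2 *m W ^+ 2 = W ^+ 4 by rewrite mulmxE -exprD.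
have W3 : W ^+ 2 *m W = W ^+ 3 by rewrite mulmxE -exprSr.
have W3' : W *m W ^+ 2 = W ^+ 3 by rewrite mulmxE -exprS.
have W2 : W *m W = W ^+ 2 by rewrite mulmxE -expr2.
rewrite (exprM _ 2 2) affine_mx_sqr expr2 -mulmxE !(mulmxDl, mulmxDr).
rewrite -!scalemxAl -!scalemxAr !(mulmx1, mul1mx) W4 W3 W3' W2 !scalerA.
apply/matrixP => i j; rewrite !mxE; ring.
Qed.

End AffineMatrixPowers.

Section HermitianTraces.
Variable C : numClosedFieldType.

Lemma hermitian_mxtrace_sqr_ge0 d (H : 'M[C]_d) : H^t* = H -> 0 <= \tr (H *m H).
Proof.
move=> hH; have E i j : H j i = (H i j)^* by rewrite -[in LHS]hH !mxE.
rewrite /mxtrace; apply: sumr_ge0 => i _; rewrite mxE.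
by apply: sumr_ge0 => j _; rewrite (E i) mul_conjC_ge0.
Qed.

Lemma mulmx_conj_trmx m d p (X : 'M[C]_(m, d)) (Y : 'M[C]_(d, p)) :
  (X *m Y)^t* = Y^t* *m X^t*.
Proof. by rewrite trmx_mul map_mxM. Qed.

End HermitianTraces.

Section ShiftedMoments.
Variables (R : realType) (d : nat).
Implicit Types (W : 'M[R[i]]_d) (q c : R).

Definition re_tr W : R := complex.Re (\tr W).

Lemma re_trD W V : re_tr (W + V) = re_tr W + re_tr V.
Proof. by rewrite /re_tr raddfD raddfD. Qed.

Lemma re_trZ c W : re_tr (c%:C *: W) = c * re_tr W.
Proof. by rewrite /re_tr linearZ /=; case: (\tr W) => x y /=; rewrite mul0r subr0. Qed.

Lemma re_tr1 : re_tr 1%:M = d%:R.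
Proof. by rewrite /re_tr mxtrace1 -(rmorph_nat (real_complex R)). Qed.

Lemma conj_trmx_realZ c W : (c%:C *: W)^t* = c%:C *: W^t*.
Proof.
rewrite linearZ /= map_mxZ; congr (_ *: _).
exact: conjc_real.
Qed.

(** The square of the Hermitian matrix W^2 - t W has nonnegative trace tr W^4 - 2 t tr W^3 + t^2,
    and t = tr W^3 is the minimizing choice. *)
Lemma hermitian_re_tr_cube_le W : W^t* = W -> re_tr (W ^+ 2) = 1 ->
  re_tr (W ^+ 3) ^+ 2 <= re_tr (W ^+ 4).
Proof.
move=> hW t2.
set l := - re_tr (W ^+ 3).
pose H := W ^+ 2 + l%:C *: W.
have hH : H^t* = H.
  by rewrite /H raddfD /= map_mxD conj_trmx_realZ hW expr2 -mulmxE mulmx_conj_trmx hW.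
have := hermitian_mxtrace_sqr_ge0 hH.
rewrite lecE => /andP[_] /=.
have -> : H *m H = W ^+ 4 + ((2 * l)%:C *: W ^+ 3 + (l ^+ 2)%:C *: W ^+ 2).
  rewrite /H mulmxDl !mulmxDr -!scalemxAl -!scalemxAr scalerA -!addrA !mulmxE.
  rewrite -!exprD -!exprS -!exprSr; congr (_ + _).
  by rewrite addrA -scalerDl -!rmorphD -rmorphM /= mulr2n mulrDl mul1r -expr2.
rewrite -/(re_tr _) !re_trD !re_trZ t2 /l; lra.
Qed.

Section Affine.
Variables (W : 'M[R[i]]_d) (q c : R).
Hypotheses (hW : W^t* = W) (W1 : re_tr W = 1) (W2 : re_tr (W ^+ 2) = 1).
Let X := q%:C *: W + c%:C *: 1%:M.

Lemma affine_re_tr_sqr : re_tr (X ^+ 2) = q ^+ 2 + 2 * q * c + c ^+ 2 * d%:R.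
Proof.
rewrite /X affine_mx_sqr.
have -> : q%:C ^+ 2 = (q ^+ 2)%:C by rewrite rmorphXn.
have -> : c%:C ^+ 2 = (c ^+ 2)%:C by rewrite rmorphXn.
have -> : 2 * q%:C * c%:C = (2 * q * c)%:C by rewrite !rmorphM rmorph_nat.
by rewrite !re_trD !re_trZ W1 W2 re_tr1 !mulr1.
Qed.

Lemma affine_re_tr_exp4 : re_tr (X ^+ 4) =
  q ^+ 4 * re_tr (W ^+ 4) + 4 * q ^+ 3 * c * re_tr (W ^+ 3) +
  6 * q ^+ 2 * c ^+ 2 + 4 * q * c ^+ 3 + c ^+ 4 * d%:R.
Proof.
rewrite /X affine_mx_exp4.
have -> : q%:C ^+ 4 = (q ^+ 4)%:C by rewrite rmorphXn.
have -> : c%:C ^+ 4 = (c ^+ 4)%:C by rewrite rmorphXn.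
have -> : 4 * q%:C ^+ 3 * c%:C = (4 * q ^+ 3 * c)%:C.
  by rewrite 2!rmorphM rmorphXn rmorph_nat.
have -> : 6 * q%:C ^+ 2 * c%:C ^+ 2 = (6 * q ^+ 2 * c ^+ 2)%:C.
  by rewrite 2!rmorphM !rmorphXn rmorph_nat.
have -> : 4 * q%:C * c%:C ^+ 3 = (4 * q * c ^+ 3)%:C.
  by rewrite 2!rmorphM rmorphXn rmorph_nat.
by rewrite !re_trD !re_trZ W1 W2 re_tr1 !mulr1.
Qed.

Lemma hermitian_affine : X^t* = X.
Proof.
by rewrite /X raddfD /= map_mxD !conj_trmx_realZ hW trmx1 map_mx1.
Qed.

Variable P : R.
Hypotheses (P0 : 0 <= P) (W4 : re_tr (W ^+ 4) = P ^+ 2).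

Lemma hermitian_re_tr_cube_norm : `|re_tr (W ^+ 3)| <= P.
Proof.
rewrite -(ger0_norm P0) -ler_sqr ?nnegrE // !real_normK ?num_real // -W4.
exact: hermitian_re_tr_cube_le.
Qed.

(** Only the cubic term can be negative. It is at least - 4 q^3 c P, and the term 6 q^2 c^2 together
    with two thirds of q^4 P^2 completes it to 6 q^2 (q P / 3 - c)^2, which leaves the remaining
    third. *)
Lemma affine_re_tr_exp4_ge : 0 <= q -> 0 <= c ->
  q ^+ 4 * P ^+ 2 / 3 <= re_tr (X ^+ 4).
Proof.
move=> q0 c0; rewrite affine_re_tr_exp4 W4.
have := hermitian_re_tr_cube_norm; rewrite ler_norml => /andP[lb _].
have q3c : 0 <= q ^+ 3 * c by rewrite mulr_ge0 ?exprn_ge0.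
have qc3 : 0 <= q * c ^+ 3 by rewrite mulr_ge0 ?exprn_ge0.
have c4 : 0 <= c ^+ 4 * d%:R by rewrite mulr_ge0 ?exprn_ge0.
have := ler_wpM2l q3c lb; rewrite mulrN => lb3.
(* completing the square in [q P] and [c] *)
have := mulr_ge0 (sqr_ge0 q) (sqr_ge0 (q * P / 3 - c)).
lra.
Qed.

(** Since c is at most both q^2 and P^2, it is at most q P. Each of the five terms is then at most
    its binomial coefficient times q^4 P^2, and the coefficients add up to 2^4. *)
Lemma affine_re_tr_exp4_le : 0 <= q <= 1 -> 0 <= c -> c * d%:R <= 1 -> c <= q ^+ 2 ->
  c <= P ^+ 2 -> re_tr (X ^+ 4) <= 16 * q ^+ 4 * P ^+ 2.
Proof.
move=> /andP[q0 q1] c0 cd cq cP; rewrite affine_re_tr_exp4 W4.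
have := hermitian_re_tr_cube_norm; rewrite ler_norml => /andP[_ ub].
have cqP : c <= q * P.
  rewrite -ler_sqr ?nnegrE ?mulr_ge0 // expr2 exprMn.
  exact: ler_pM.
have q3c : 0 <= q ^+ 3 * c by rewrite mulr_ge0 ?exprn_ge0.
have t3 : q ^+ 3 * c * re_tr (W ^+ 3) <= q ^+ 4 * P ^+ 2.
  apply: le_trans (ler_wpM2l q3c ub) _.
  rewrite (_ : q ^+ 4 * P ^+ 2 = q ^+ 3 * P * (q * P)); last by ring.
  rewrite (_ : q ^+ 3 * c * P = q ^+ 3 * P * c); last by ring.
  by apply: ler_wpM2l => //; rewrite mulr_ge0 ?exprn_ge0.
have c2 : c ^+ 2 <= q ^+ 2 * P ^+ 2.
  by rewrite -exprMn ler_sqr ?nnegrE ?mulr_ge0.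
have t2 : q ^+ 2 * c ^+ 2 <= q ^+ 4 * P ^+ 2.
  by rewrite (exprD q 2 2) -mulrA; apply: ler_wpM2l => //; exact: sqr_ge0.
have c3 : c ^+ 3 <= q ^+ 4 * P ^+ 2.
  rewrite exprS (exprD q 2 2) -mulrA; apply: ler_pM => //; exact: exprn_ge0.
have t1 : q * c ^+ 3 <= c ^+ 3 by apply: ler_piMl => //; exact: exprn_ge0.
have t0 : c ^+ 4 * d%:R <= c ^+ 3.
  by rewrite exprSr -mulrA; apply: ler_piMr => //; exact: exprn_ge0.
lra.
Qed.

End Affine.
End ShiftedMoments.

(** * Trace norm against the second and fourth moments *)

Section TraceNorm.
Variables (R : realType) (d : nat) (X : 'M[R[i]]_d).
Hypothesis hX : X^t* = X.

Let G := X^t* *m X.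
Let s := spectral_diag G.
Let U := spectralmx G.

Let GE : G = U^t* *m diag_mx s *m U.
Proof.
have nG : G \is normalmx.
  by apply/normalmxP; rewrite /G mulmx_conj_trmx trmxCK.
by rewrite -invmx_unitary ?spectral_unitarymx //; exact: orthomx_spectralP.
Qed.

Let UU : U *m U^t* = 1%:M.
Proof. exact/unitarymxP/spectral_unitarymx. Qed.

Lemma spectral_diag_gram_ge0 j : 0 <= s 0 j.
Proof.
have -> : s 0 j = ((X *m U^t*)^t* *m (X *m U^t*)) j j.
  rewrite mulmx_conj_trmx trmxCK mulmxA -(mulmxA U) -/G GE !mulmxA UU mul1mx.
  by rewrite -mulmxA UU mulmx1 !mxE eqxx mulr1n.
rewrite mxE; apply: sumr_ge0 => k _; rewrite !mxE mulrC.
exact: mul_conjC_ge0.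
Qed.

Lemma spectral_diag_gram_real j : s 0 j = (complex.Re (s 0 j))%:C.
Proof. by rewrite RRe_real // ger0_real // spectral_diag_gram_ge0. Qed.

Lemma mxtrace_spectral_conj (M : 'M[R[i]]_d) : \tr (U^t* *m M *m U) = \tr M.
Proof. by rewrite mxtrace_mulC mulmxA UU mul1mx. Qed.

(** As [X] is Hermitian, X^2 is the Gram matrix [G] from whose eigenvalues [trace_norm] is computed.
    All three quantities are thus power sums of the singular values, and [X] itself is never
    diagonalized. *)
Lemma trace_norm_cube_le :
  re_tr (X ^+ 2) ^+ 3 <= trace_norm X ^+ 2 * re_tr (X ^+ 4).
Proof.
have XG : X ^+ 2 = G by rewrite /G hX expr2 mulmxE.
rewrite (exprM _ 2 2) XG (expr2 G) -mulmxE.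
have -> : re_tr G = \sum_j Num.sqrt (complex.Re (s 0 j)) ^+ 2.
  rewrite /re_tr GE mxtrace_spectral_conj mxtrace_diag raddf_sum /=.
  apply: eq_bigr => j _; rewrite sqr_sqrtr //.
  by rewrite -ler0c -spectral_diag_gram_real spectral_diag_gram_ge0.
have -> : re_tr (G *m G) = \sum_j Num.sqrt (complex.Re (s 0 j)) ^+ 4.
  have -> : G *m G = U^t* *m (diag_mx s *m diag_mx s) *m U.
    by rewrite GE !mulmxA -(mulmxA (U^t* *m diag_mx s) U) UU mulmx1.
  rewrite /re_tr mxtrace_spectral_conj mulmx_diag mxtrace_diag raddf_sum /=.
  apply: eq_bigr => j _; rewrite !mxE (exprM _ 2 2) sqr_sqrtr; last first.
    by rewrite -ler0c -spectral_diag_gram_real spectral_diag_gram_ge0.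
  by rewrite spectral_diag_gram_real -rmorphM /= -expr2.
by apply: sum_sqr_cube_le => j; rewrite sqrtr_ge0.
Qed.

End TraceNorm.

(** * Purity of bipartite pure states *)

Section Purity.
Variables (C : numClosedFieldType) (S S' : finType).
Implicit Types (f : S -> S' -> C).

(** This is tr(rho_A^2) for the pure state with amplitudes [f], expanded into monomials in four
    amplitudes so that it can be averaged term by term. *)
Definition purity f : C :=
  \sum_a \sum_a' \sum_b \sum_b' f a b * (f a' b)^* * f a' b' * (f a b')^*.

(** Entry of the reduced density matrix on the first factor. *)
Definition marginal f a a' : C := \sum_b f a b * (f a' b)^*.

Lemma exchange_big_pairs (F : S -> S -> S' -> S' -> C) :
  \sum_a \sum_a' \sum_b \sum_b' F a a' b b' =
  \sum_b \sum_b' \sum_a \sum_a' F a a' b b'.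
Proof.
rewrite pair_bigA /=; under eq_bigr do rewrite pair_bigA /=.
rewrite exchange_big /= -(pair_bigA _ (fun b b' => \sum_p F p.1 p.2 b b')) /=.
do 2!apply: eq_bigr => ? _.
by rewrite -(pair_bigA _ (fun a a' => F a a' _ _)).
Qed.

Lemma marginal_conj f a a' : (marginal f a a')^* = marginal f a' a.
Proof.
rewrite /marginal rmorph_sum; apply: eq_bigr => b _.
by rewrite rmorphM /= conjCK mulrC.
Qed.

Lemma purityE f : purity f = \sum_a \sum_a' marginal f a a' * marginal f a' a.
Proof.
apply: eq_bigr => a _; apply: eq_bigr => a' _.
rewrite /marginal big_distrlr /=.
by do 2!apply: eq_bigr => ? _; rewrite mulrA.
Qed.

Lemma marginal_ge0 f a : 0 <= marginal f a a.
Proof. by apply: sumr_ge0 => b _; exact: mul_conjC_ge0. Qed.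

Lemma purity_ge f : \sum_a marginal f a a ^+ 2 <= purity f.
Proof.
rewrite purityE; apply: ler_sum => a _; rewrite (bigD1 a) //= -expr2 lerDl.
by apply: sumr_ge0 => a' _; rewrite -(marginal_conj f a) mul_conjC_ge0.
Qed.

(** The diagonal of the reduced state sums to 1, and its squared deviation from the uniform value 1
    / #|S| is nonnegative. *)
Lemma card_purity_ge1 f : \sum_a marginal f a a = 1 -> 1 <= #|S|%:R * purity f.
Proof.
move=> f1; apply: le_trans (ler_wpM2l (ler0n _ _) (purity_ge f)).
have S0 : (0 < #|S|)%N.
  rewrite lt0n; apply/negP => /eqP/card0_eq S0; move: f1.
  by rewrite big_pred0 // => /esym/eqP; rewrite oner_eq0.
have : 0 <= \sum_a (#|S|%:R * marginal f a a - 1) ^+ 2.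
  apply: sumr_ge0 => a _; apply: real_exprn_even_ge0 => //.
  by rewrite rpredB ?rpredM ?rpred1 ?ger0_real ?marginal_ge0.
have -> : \sum_a (#|S|%:R * marginal f a a - 1) ^+ 2 =
    #|S|%:R * (#|S|%:R * (\sum_a marginal f a a ^+ 2) - 1).
  under eq_bigr => a _.
    rewrite (_ : _ ^+ 2 = #|S|%:R ^+ 2 * marginal f a a ^+ 2
      - 2 * #|S|%:R * marginal f a a + 1); last by ring.
    over.
  by rewrite big_split sumrB /= -!mulr_sumr f1 sumr_const; ring.
by rewrite pmulr_rge0 ?ltr0n // subr_ge0.
Qed.

End Purity.

(** Both reduced states of a pure state have the same purity; this makes the lower bound available
    for the smaller of the two dimensions. *)
Lemma purity_swap (C : numClosedFieldType) (S S' : finType) (f : S -> S' -> C) :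
  purity (fun b a => f a b) = purity f.
Proof.
rewrite /purity [RHS]exchange_big_pairs; do 4!apply: eq_bigr => ? _; ring.
Qed.

Lemma card_bitstrings (I : finType) (A : {set I}) :
  #|{: {ffun {i | i \in A} -> bool}}| = (2 ^ #|A|)%N.
Proof. by rewrite card_ffun card_bool card_sig. Qed.

(** * Basis states indexed by a bipartition *)

Section Bipartition.
Variables (I : finType) (A : {set I}).
Notation SA := {ffun {i | i \in A} -> bool}.
Notation SB := {ffun {i | i \in ~: A} -> bool}.

(** The final [false] is never reached, since every index lies in [A] or in its complement. *)
Definition glue (a : SA) (b : SB) : {ffun I -> bool} :=
  [ffun i => if insub i is Some u then a u
             else if insub i is Some w then b w else false].

Lemma restr_glue a b : restr A (glue a b) = a.
Proof. by apply/ffunP => u; rewrite !ffunE valK. Qed.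

Lemma restrC_glue a b : restr (~: A) (glue a b) = b.
Proof.
apply/ffunP => w; rewrite !ffunE valK insubN //.
by have := valP w; rewrite finset.in_setC.
Qed.

Lemma glue_restr x : glue (restr A x) (restr (~: A) x) = x.
Proof.
apply/ffunP => i; rewrite ffunE; case: insubP => [u _ <-|iA]; rewrite ?ffunE //.
case: insubP => [w _ <-|]; rewrite ?ffunE //.
by rewrite finset.in_setC iA.
Qed.

(** On glued strings the partial transpose exchanges the B labels only, so a pure state has entry f
    a b' * (f a' b)^* at row (a, b) and column (a', b'). *)
Lemma splice_glue a b a' b' : splice (~: A) (glue a b) (glue a' b') = glue a b'.
Proof.
rewrite -[LHS]glue_restr; congr glue; apply/ffunP => i.
  rewrite !ffunE finset.in_setC (valP i) /= ?valK.
  by have /ffunP/(_ i) := restr_glue a b; rewrite !ffunE.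
rewrite !ffunE (valP i).
by have /ffunP/(_ i) := restrC_glue a' b'; rewrite !ffunE.
Qed.

Lemma sum_glue (V : nmodType) (F : {ffun I -> bool} -> V) :
  \sum_x F x = \sum_a \sum_b F (glue a b).
Proof.
rewrite pair_bigA /= (reindex (fun p : SA * SB => glue p.1 p.2)) //=.
exists (fun x => (restr A x, restr (~: A) x)) => [[a b]|x] _.
  by rewrite restr_glue restrC_glue.
by rewrite glue_restr.
Qed.

Definition qidx a b : 'I_(qdim I) := enum_rank (glue a b).

Lemma qidx_inj a b a' b' : (qidx a b == qidx a' b') = (a == a') && (b == b').
Proof.
apply/eqP/andP => [/enum_rank_inj E|[/eqP-> /eqP->]//].
move: (restr_glue a b) (restrC_glue a b).
by rewrite E restr_glue restrC_glue => -> ->; rewrite !eqxx.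
Qed.

Lemma sum_qidx (V : nmodType) (F : 'I_(qdim I) -> V) :
  \sum_j F j = \sum_a \sum_b F (qidx a b).
Proof.
rewrite (reindex (@enum_rank {ffun I -> bool})); first exact: sum_glue.
exact/onW_bij/enum_rank_bij.
Qed.

Lemma qidx_surj j : exists a b, j = qidx a b.
Proof.
exists (restr A (enum_val j)), (restr (~: A) (enum_val j)).
by rewrite /qidx glue_restr enum_valK.
Qed.

Section PureState.
Variables (R : realType) (v : 'cV[R[i]]_(qdim I)).

Definition amplitude a b : R[i] := v (qidx a b) 0.

Let W := ptranspose (~: A) (v *m v^t* ).
Local Notation f := amplitude.

Lemma ptranspose_pureE a b a' b' :
  W (qidx a b) (qidx a' b') = f a b' * (f a' b)^*.
Proof.
by rewrite !mxE big_ord1 !mxE !enum_rankK !splice_glue.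
Qed.

Lemma ptranspose_pure_hermitian : W^t* = W.
Proof.
apply/matrixP => j k; have [a [b ->]] := qidx_surj j.
have [a' [b' ->]] := qidx_surj k.
rewrite mxE [X in X^* = _]mxE.
by rewrite !ptranspose_pureE rmorphM /= conjCK mulrC.
Qed.

Let marg' b b' : R[i] := \sum_a (f a b)^* * f a b'.

(** W^2 is the tensor product of the reduced state on A and the complex conjugate of the one on B.
    Hence tr W^2 is a product of two traces and tr W^4 a product of two purities. *)
Lemma ptranspose_pure_sqrE a b a' b' :
  (W ^+ 2) (qidx a b) (qidx a' b') = marginal f a a' * marg' b b'.
Proof.
rewrite expr2 -mulmxE mxE sum_qidx /marginal /marg' mulrC big_distrlr /=.
apply: eq_bigr => a1 _; apply: eq_bigr => b1 _.
rewrite !ptranspose_pureE; ring.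
Qed.

Hypothesis v1 : v^t* *m v = 1%:M.

Lemma sum_amplitude_sqr : \sum_a \sum_b f a b * (f a b)^* = 1.
Proof.
have /matrixP/(_ 0 0) := v1; rewrite !mxE eqxx mulr1n => <-; rewrite sum_qidx.
by apply: eq_bigr => a _; apply: eq_bigr => b _; rewrite !mxE mulrC.
Qed.

Lemma sum_marginal : \sum_a marginal f a a = 1.
Proof. exact: sum_amplitude_sqr. Qed.

Lemma sum_marginal' : \sum_b marg' b b = 1.
Proof.
rewrite -sum_amplitude_sqr exchange_big; apply: eq_bigr => b _.
by apply: eq_bigr => a _; rewrite mulrC.
Qed.

Lemma ptranspose_pure_tr : \tr W = 1.
Proof.
rewrite /mxtrace sum_qidx -sum_amplitude_sqr.
by apply: eq_bigr => a _; apply: eq_bigr => b _; rewrite ptranspose_pureE.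
Qed.

Lemma ptranspose_pure_tr2 : \tr (W ^+ 2) = 1.
Proof.
rewrite /mxtrace sum_qidx; under eq_bigr do under eq_bigr do
  rewrite ptranspose_pure_sqrE.
by rewrite -big_distrlr sum_marginal sum_marginal' /= mulr1.
Qed.

Lemma ptranspose_pure_tr4 : \tr (W ^+ 4) = purity f ^+ 2.
Proof.
rewrite (exprM _ 2 2) [in LHS]expr2 -mulmxE.
rewrite /mxtrace sum_qidx [RHS]expr2 {1}purityE.
(* The second factor is the purity on the B side, which equals the one on the A side. *)
have -> : purity f = \sum_b \sum_b' marg' b b' * marg' b' b.
  rewrite /purity exchange_big_pairs; apply: eq_bigr => b _; apply: eq_bigr => b' _.
  rewrite /marg' big_distrlr exchange_big /=.
  by do 2!apply: eq_bigr => ? _; ring.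
rewrite big_distrlr /=; apply: eq_bigr => a _; apply: eq_bigr => b _.
rewrite mxE sum_qidx big_distrlr /=; apply: eq_bigr => a' _; apply: eq_bigr => b' _.
by rewrite !ptranspose_pure_sqrE; ring.
Qed.

End PureState.
End Bipartition.

(** * Moments and negativity of depolarized states *)

Section DepolarizedState.
Variables (R : realType) (I : finType) (A : {set I}).
Variables (v : 'cV[R[i]]_(qdim I)) (p : R).
Hypothesis v1 : v^t* *m v = 1%:M.
Hypotheses (p0 : 0 <= p) (p1 : p < 1).

Let W := ptranspose (~: A) (v *m v^t* ).
Let q : R := 1 - p.
Let c : R := p / 2 ^+ #|I|.
Let M := depolarized p v.
Local Notation moment k := (pt_moment (~: A) k%N M).

Definition rpurity : R := complex.Re (purity (@amplitude _ A _ v)).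
Local Notation P := rpurity.

Lemma purity_ge0 : 0 <= purity (@amplitude _ A _ v).
Proof.
apply: le_trans (purity_ge _); apply: sumr_ge0 => a _.
by rewrite exprn_ge0 ?marginal_ge0.
Qed.

Lemma rpurityE : purity (@amplitude _ A _ v) = P%:C.
Proof. by rewrite RRe_real // ger0_real // purity_ge0. Qed.

Lemma rpurity_ge_dimA : (2 ^+ #|A|)^-1 <= P.
Proof.
have := card_purity_ge1 (sum_marginal A v1).
rewrite rpurityE -(rmorph_nat (real_complex R)) -rmorphM lecE => /andP[_] /=.
by rewrite card_bitstrings natrX mulrC -ler_pdivrMr ?exprn_gt0 // div1r.
Qed.

Lemma rpurity_ge_dimB : (2 ^+ #|~: A|)^-1 <= P.
Proof.
have := @card_purity_ge1 _ _ _ (fun b a => @amplitude _ A _ v a b).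
rewrite purity_swap rpurityE -(rmorph_nat (real_complex R)) -rmorphM lecE /=.
rewrite card_bitstrings natrX.
have -> : \sum_a marginal (fun b a => @amplitude _ A _ v a b) a a = 1.
  by rewrite -(sum_amplitude_sqr A v1) [RHS]exchange_big.
move=> /(_ erefl)/andP[_].
by rewrite mulrC -ler_pdivrMr ?exprn_gt0 // div1r.
Qed.

Lemma rpurity_gt0 : 0 < P.
Proof. by apply: lt_le_trans rpurity_ge_dimA; rewrite invr_gt0 exprn_gt0. Qed.

Lemma rpurity_ge_min : (2 ^+ minn #|A| #|~: A|)^-1 <= P.
Proof.
by rewrite /minn; case: ifP => _; [exact: rpurity_ge_dimA|exact: rpurity_ge_dimB].
Qed.

Lemma rpurity_sqr_ge : (2 ^+ #|I|)^-1 <= P ^+ 2.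
Proof.
rewrite -(cardsC A) exprD invfM expr2.
by apply: ler_pM; rewrite ?invr_ge0 ?exprn_ge0 ?rpurity_ge_dimA ?rpurity_ge_dimB.
Qed.

Lemma ptranspose_depolarized :
  ptranspose (~: A) M = q%:C *: W + c%:C *: 1%:M.
Proof.
apply/matrixP => j k; have [a [b ->]] := qidx_surj A j.
have [a' [b' ->]] := qidx_surj A k.
rewrite [RHS]mxE [X in _ = X + _]mxE ptranspose_pureE.
rewrite !mxE big_ord1 !mxE !enum_rankK !splice_glue.
by rewrite -!/(qidx _ _) !qidx_inj (eq_sym b' b).
Qed.

Let W1 : re_tr W = 1.
Proof. by rewrite /re_tr ptranspose_pure_tr. Qed.

Let W2 : re_tr (W ^+ 2) = 1.
Proof. by rewrite /re_tr ptranspose_pure_tr2. Qed.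

Let W4 : re_tr (W ^+ 4) = P ^+ 2.
Proof. by rewrite /re_tr ptranspose_pure_tr4 // rpurityE -rmorphXn. Qed.

Let qp : q + p = 1. Proof. by rewrite /q subrK. Qed.
Let q_gt0 : 0 < q. Proof. by rewrite subr_gt0. Qed.
Let D_gt0 : 0 < (2 : R) ^+ #|I|. Proof. exact: exprn_gt0. Qed.
Let c_ge0 : 0 <= c. Proof. by rewrite divr_ge0 // ltW. Qed.
Let cD : c * (qdim I)%:R = p.
Proof. by rewrite qdimE natrX divfK // gt_eqF. Qed.

Lemma pt_moment2E : moment 2 = q ^+ 2 + 2 * q * c + c * p.
Proof.
rewrite /pt_moment ptranspose_depolarized -/(re_tr _) affine_re_tr_sqr //.
by rewrite (expr2 c) -(mulrA c) cD.
Qed.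

Lemma pt_moment2_ge : q ^+ 2 <= moment 2.
Proof.
by rewrite pt_moment2E -addrA lerDl addr_ge0 ?mulr_ge0 // ltW.
Qed.

(** Replacing c by the larger p turns the expression into (q + p)^2 = 1. *)
Lemma pt_moment2_le1 : moment 2 <= 1.
Proof.
rewrite pt_moment2E.
have cp : c <= p by rewrite ler_pdivrMr // ler_peMr // exprn_ege1 // ler1n.
have : 2 * q * c <= 2 * q * p by rewrite ler_wpM2l // mulr_ge0 // ltW.
have : c * p <= p * p by rewrite ler_wpM2r.
have -> : q = 1 - p by [].
lra.
Qed.

Lemma pt_moment4_ge : q ^+ 4 * P ^+ 2 / 3 <= moment 4.
Proof.
rewrite /pt_moment ptranspose_depolarized -/(re_tr _).
apply: affine_re_tr_exp4_ge => //; last exact: ltW.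
- exact: ptranspose_pure_hermitian.
- exact/ltW/rpurity_gt0.
Qed.

Lemma pt_moment4_le : (2 ^+ #|I|)^-1 <= q ^+ 2 ->
  moment 4 <= 16 * q ^+ 4 * P ^+ 2.
Proof.
move=> Dq; have cD1 : c <= (2 ^+ #|I|)^-1.
  by rewrite ler_piMl ?invr_ge0 ?ltW.
rewrite /pt_moment ptranspose_depolarized -/(re_tr _).
apply: affine_re_tr_exp4_le => //.
- exact: ptranspose_pure_hermitian.
- exact/ltW/rpurity_gt0.
- by rewrite ltW //= /q lerBlDr lerDl.
- by rewrite cD ltW.
- exact: le_trans Dq.
- exact: le_trans rpurity_sqr_ge.
Qed.

Let moment2_gt0 : 0 < moment 2.
Proof. by apply: lt_le_trans pt_moment2_ge; rewrite exprn_gt0. Qed.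

Let moment4_gt0 : 0 < moment 4.
Proof.
apply: lt_le_trans pt_moment4_ge.
by rewrite divr_gt0 // mulr_gt0 // exprn_gt0 // rpurity_gt0.
Qed.

Lemma pt_E4E :
  pt_E4 (~: A) M = 2^-1 * (3 * ln (moment 2) - ln (moment 4)).
Proof.
by rewrite /pt_E4 ln_div ?posrE ?exprn_gt0 // lnXn // mulr_natl.
Qed.

Lemma pt_E4_le :
  pt_E4 (~: A) M <= (minn #|A| #|~: A|)%:R * ln 2 + (ln 3 / 2 - 2 * ln q).
Proof.
rewrite pt_E4E.
have h2 : ln (moment 2) <= 0 by apply: ln_le0; exact: pt_moment2_le1.
have h4 : 4 * ln q + 2 * ln P - ln 3 <= ln (moment 4).
  apply: le_trans (_ : ln (q ^+ 4 * P ^+ 2 / 3) <= _).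
    rewrite ln_div ?posrE ?mulr_gt0 ?exprn_gt0 ?rpurity_gt0 //.
    rewrite lnM ?posrE ?exprn_gt0 ?rpurity_gt0 // !lnXn ?rpurity_gt0 //.
    by rewrite !mulr_natl.
  rewrite ler_ln ?posrE ?pt_moment4_ge //.
  by rewrite divr_gt0 // mulr_gt0 // exprn_gt0 // rpurity_gt0.
have hP : - ((minn #|A| #|~: A|)%:R * ln 2) <= ln P.
  rewrite mulr_natl -lnXn // -lnV ?posrE ?exprn_gt0 //.
  by rewrite ler_ln ?posrE ?invr_gt0 ?exprn_gt0 ?rpurity_gt0 ?rpurity_ge_min.
suff arith (x y z u w t : R) : x <= 0 -> 4 * z + 2 * u - w <= y -> - t <= u ->
  2^-1 * (3 * x - y) <= t + (w / 2 - 2 * z) by exact: arith h2 h4 hP.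
by move=> *; lra.
Qed.

(** The single [ln q] is half of the balance between 6 ln q from p_2^3 and 4 ln q from p_4; under
    exponential noise it is the whole loss. *)
Lemma pt_E4_ge : (2 ^+ #|I|)^-1 <= q ^+ 2 ->
  ln q - ln 16 / 2 - ln P <= pt_E4 (~: A) M.
Proof.
move=> Dq; rewrite pt_E4E.
have h2 : 2 * ln q <= ln (moment 2).
  by rewrite mulr_natl -lnXn // ler_ln ?posrE ?exprn_gt0 ?pt_moment2_ge.
have h4 : ln (moment 4) <= ln 16 + 4 * ln q + 2 * ln P.
  apply: (@le_trans _ _ (ln (16 * q ^+ 4 * P ^+ 2))).
    by rewrite ler_ln ?posrE ?pt_moment4_le ?mulr_gt0 ?exprn_gt0 ?rpurity_gt0.
  rewrite 2?lnM ?posrE ?mulr_gt0 ?exprn_gt0 ?rpurity_gt0 //.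
  by rewrite !lnXn ?rpurity_gt0 // !mulr_natl.
suff arith (x y z u w : R) : 2 * z <= x -> y <= w + 4 * z + 2 * u ->
  z - w / 2 - u <= 2^-1 * (3 * x - y) by exact: arith h2 h4.
by move=> *; lra.
Qed.

Lemma pt_E4_le_negativity : pt_E4 (~: A) M <= pt_negativity (~: A) M.
Proof.
have hX : (ptranspose (~: A) M)^t* = ptranspose (~: A) M.
  rewrite ptranspose_depolarized hermitian_affine //.
  exact: ptranspose_pure_hermitian.
have := trace_norm_cube_le hX; rewrite -ler_pdivrMr ?moment4_gt0 //.
set N := trace_norm _ => le_N.
have N0 : 0 <= N by apply: sumr_ge0 => j _; exact: sqrtr_ge0.
have E0 : 0 < moment 2 ^+ 3 / moment 4 by rewrite divr_gt0 ?exprn_gt0.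
have N1 : 0 < N.
  rewrite lt_def N0 andbT; apply/eqP => Nz.
  by move: (lt_le_trans E0 le_N); rewrite Nz expr0n /= ltxx.
rewrite /pt_negativity /pt_E4 -/N.
rewrite mulrC ler_pdivrMr // mulr_natr -lnXn //.
by rewrite ler_ln ?posrE ?exprn_gt0.
Qed.

End DepolarizedState.

(** * Bounded random variables *)

HB.instance Definition _ (R : realType) := isPointed.Build R[i] 0.

(** The same polynomials in the amplitudes must be shown measurable on vectors and bounded
    measurable as random variables, over the reals and over the complex numbers. Abstracting the
    class [Q] gives one closure argument for all cases. *)
Definition function_algebra (R : pzRingType) T (Q : (T -> R) -> Prop) : Prop :=
  [/\ forall c, Q (fun=> c),
      forall f g, Q f -> Q g -> Q (fun t => f t + g t) &
      forall f g, Q f -> Q g -> Q (fun t => f t * g t)].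

Section FunctionAlgebra.
Variables (R : pzRingType) (T : Type) (Q : (T -> R) -> Prop).
Hypothesis algQ : function_algebra Q.

Lemma function_algebra_cst c : Q (fun=> c).
Proof. by case: algQ. Qed.

Lemma function_algebraD f g : Q f -> Q g -> Q (fun t => f t + g t).
Proof. by case: algQ => _ + _; exact. Qed.

Lemma function_algebraM f g : Q f -> Q g -> Q (fun t => f t * g t).
Proof. by case: algQ => _ _; exact. Qed.

Lemma function_algebraN f : Q f -> Q (fun t => - f t).
Proof.
move=> Qf; rewrite (_ : (fun t => _) = fun t => -1 * f t).
  exact: function_algebraM (function_algebra_cst _) Qf.
by apply/funext => t; rewrite mulN1r.
Qed.

Lemma function_algebraX f k : Q f -> Q (fun t => f t ^+ k).
Proof.
move=> Qf; elim: k => [|k IH]; first exact: function_algebra_cst.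
rewrite (_ : (fun t => _) = fun t => f t * f t ^+ k).
  exact: function_algebraM.
by apply/funext => t; rewrite exprS.
Qed.

Lemma function_algebra_sum (J : finType) (f : J -> T -> R) :
  (forall j, Q (f j)) -> Q (fun t => \sum_j f j t).
Proof.
move=> Qf; elim: (index_enum J) => [|j s IH].
  rewrite (_ : (fun t => _) = fun=> 0); first exact: function_algebra_cst.
  by apply/funext => t; rewrite big_nil.
rewrite (_ : (fun t => _) = fun t => f j t + \sum_(i <- s) f i t).
  exact: function_algebraD.
by apply/funext => t; rewrite big_cons.
Qed.

End FunctionAlgebra.

Section Complexify.
Variables (R : realType) (T : Type) (Q : (T -> R) -> Prop).
Hypothesis algQ : function_algebra Q.

(** Complex-valued functions are handled through their real and imaginary parts, so that only real
    integrals occur. *)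
Definition complexify (f : T -> R[i]) : Prop :=
  Q (fun t => complex.Re (f t)) /\ Q (fun t => complex.Im (f t)).

Lemma complexify_algebra : function_algebra complexify.
Proof.
split=> [c|f g [Qf Qf'] [Qg Qg']|f g [Qf Qf'] [Qg Qg']].
- by split; exact: (function_algebra_cst algQ).
- split.
    rewrite (_ : (fun t => _) = fun t => complex.Re (f t) + complex.Re (g t)).
      exact: (function_algebraD algQ).
    by apply/funext => t; rewrite raddfD.
  rewrite (_ : (fun t => _) = fun t => complex.Im (f t) + complex.Im (g t)).
    exact: (function_algebraD algQ).
  by apply/funext => t; rewrite raddfD.
- split.
    rewrite (_ : (fun t => _) = fun t =>
      complex.Re (f t) * complex.Re (g t) + - (complex.Im (f t) * complex.Im (g t))).
      apply: (function_algebraD algQ); first exact: (function_algebraM algQ).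
      by apply: (function_algebraN algQ); exact: (function_algebraM algQ).
    by apply/funext => t; case: (f t) (g t) => [? ?] [].
  rewrite (_ : (fun t => _) = fun t =>
    complex.Re (f t) * complex.Im (g t) + complex.Im (f t) * complex.Re (g t)).
    by apply: (function_algebraD algQ); exact: (function_algebraM algQ).
  by apply/funext => t; case: (f t) (g t) => [? ?] [].
Qed.

Lemma complexify_conj f : complexify f -> complexify (fun t => (f t)^*).
Proof.
move=> [Qf Qf']; split.
  rewrite (_ : (fun t => _) = fun t => complex.Re (f t)) //.
  by apply/funext => t; case: (f t).
rewrite (_ : (fun t => _) = fun t => - complex.Im (f t)).
  exact: (function_algebraN algQ).
by apply/funext => t; case: (f t).
Qed.

End Complexify.

Section BoundedMeasurable.
Variables (R : realType) (dT : measure_display) (T : measurableType dT).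

Lemma measurable_algebra :
  function_algebra (fun f : T -> R => measurable_fun setT f).
Proof.
by split=> [c|f g|f g]; [exact: measurable_cst|exact: measurable_funD|
  exact: measurable_funM].
Qed.

(** Unlike integrability, this property is stable under products, and it implies integrability under
    a probability. *)
Definition bounded_measurable (f : T -> R) : Prop :=
  measurable_fun setT f /\ exists M : R, forall t, `|f t| <= M.

Lemma bounded_measurable_algebra : function_algebra bounded_measurable.
Proof.
split=> [c|f g [mf [M fM]] [mg [N gN]]|f g [mf [M fM]] [mg [N gN]]].
- by split; [exact: measurable_cst|exists `|c|].
- split; first exact: measurable_funD.
  by exists (M + N) => t; rewrite (le_trans (ler_normD _ _)) ?lerD.
- split; first exact: measurable_funM.
  by exists (M * N) => t; rewrite normrM ler_pM.
Qed.

Variable P : probability T R.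

Lemma bounded_measurable_integrable f : bounded_measurable f ->
  P.-integrable setT (EFin \o f).
Proof.
move=> [mf [M fM]]; apply: measurable_bounded_integrable => //.
  exact: le_lt_trans (probability_le1 P measurableT) (ltry 1).
exists M; split; first exact: num_real.
by move=> x Mx t _; apply: le_trans (fM t) (ltW Mx).
Qed.

Local Notation E f := (Rintegral P setT f).

Lemma bounded_mean_expectation f : bounded_measurable f ->
  ('E_P[f] = (E f)%:E)%E.
Proof.
move=> bf; rewrite unlock fineK //; apply: integrable_fin_num => //.
exact: bounded_measurable_integrable.
Qed.

Lemma bounded_meanD f g : bounded_measurable f -> bounded_measurable g ->
  E (fun t => f t + g t) = E f + E g.
Proof. by move=> bf bg; apply: RintegralD => //; exact: bounded_measurable_integrable. Qed.

Lemma bounded_meanZ c f : bounded_measurable f -> E (fun t => c * f t) = c * E f.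
Proof. by move=> bf; apply: RintegralZl => //; exact: bounded_measurable_integrable. Qed.

Lemma bounded_mean_le f g : bounded_measurable f -> bounded_measurable g ->
  (forall t, f t <= g t) -> E f <= E g.
Proof.
move=> bf bg fg; apply: le_Rintegral => //; exact: bounded_measurable_integrable.
Qed.

Lemma mean_cst c : E (fun=> c) = c.
Proof.
rewrite Rintegral_cst //.
by rewrite [X in fine X](probability_setT P) mulr1.
Qed.

Lemma bounded_mean_sum (J : finType) (f : J -> T -> R) :
  (forall j, bounded_measurable (f j)) ->
  E (fun t => \sum_j f j t) = \sum_j E (f j).
Proof.
move=> bf; pose Q s := bounded_measurable (fun t => \sum_(j <- s) f j t).
suff : forall s, Q s /\ E (fun t => \sum_(j <- s) f j t) = \sum_(j <- s) E (f j).
  by move=> /(_ (index_enum J))[].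
elim=> [|j s [bs IH]].
  rewrite big_nil /Q (_ : (fun t => _) = fun=> 0).
    by rewrite mean_cst; split=> //; case: bounded_measurable_algebra.
  by apply/funext => t; rewrite big_nil.
rewrite big_cons -IH /Q (_ : (fun t => _) = fun t => f j t + \sum_(i <- s) f i t).
  by rewrite bounded_meanD //; split=> //; case: bounded_measurable_algebra => _ + _; exact.
by apply/funext => t; rewrite big_cons.
Qed.

(** Both means are integrals of the identity against the pushforward laws, which agree on measurable
    sets. *)
Lemma eq_law_mean (X Y : T -> R) : bounded_measurable X -> bounded_measurable Y ->
  (forall S, measurable S -> P (X @^-1` S) = P (Y @^-1` S)) -> E X = E Y.
Proof.
move=> bX bY XY.
have mX : measurable_fun setT X by case: bX.
have mY : measurable_fun setT Y by case: bY.
have mE : measurable_fun [set: R] (@EFin R) by exact/measurable_EFinP.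
congr fine.
have := integral_pushforward mX mE (bounded_measurable_integrable bX) measurableT.
have := integral_pushforward mY mE (bounded_measurable_integrable bY) measurableT.
rewrite !preimage_setT => <- <-.
by apply: eq_measure_integral => S mS _; exact: XY.
Qed.

End BoundedMeasurable.

(** * Moments of Haar random states *)

Section RankOneUnitary.
Variables (C : numClosedFieldType) (d : nat).
Implicit Types (w v : 'cV[C]_d) (k s : C).

Definition rank_one_update k w : 'M[C]_d := 1%:M - k *: (w *m w^t*).

(** For nonzero [w] the update multiplies [w] by 1 - k s and fixes its orthogonal complement; the
    scalar equation says that this factor has modulus 1. The sign flip uses s = 1 and k = 2, the
    mixing of two amplitudes s = 2 and k = (1 - i) / 2. *)
Lemma rank_one_update_unitary k w s :
  w^t* *m w = s%:M -> k + k^* = k * k^* * s -> rank_one_update k w \is unitarymx.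
Proof.
move=> ws ks; apply/unitarymxP.
have -> : (rank_one_update k w)^t* = 1%:M - k^* *: (w *m w^t*).
  rewrite /rank_one_update raddfB /= map_mxB trmx1 map_mx1; congr (_ - _).
  by rewrite linearZ /= map_mxZ mulmx_conj_trmx trmxCK.
have ww : (w *m w^t*) *m (w *m w^t*) = s *: (w *m w^t*).
  by rewrite mulmxA -(mulmxA w) ws mul_mx_scalar -scalemxAl.
rewrite /rank_one_update mulmxBl mul1mx mulmxBr mulmx1 -scalemxAl -scalemxAr ww.
rewrite !scalerA -ks; move: (w *m w^t*) => G.
by apply/matrixP => i j; rewrite !mxE; ring.
Qed.

Lemma rank_one_updateE k w v j :
  (rank_one_update k w *m v) j 0 = v j 0 - k * (w^t* *m v) 0 0 * w j 0.
Proof.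
rewrite /rank_one_update mulmxBl mul1mx -scalemxAl -mulmxA.
by move: (w^t* *m v) => z; rewrite !mxE big_ord1; ring.
Qed.

End RankOneUnitary.
Section HaarMoments.
Variables (R : realType) (dT : measure_display) (T : measurableType dT).
Variables (P : probability T R) (d : nat) (psi : T -> 'cV[R[i]]_d).
Hypothesis psi_haar : haar_random_state P psi.
Notation V := (g_sigma_algebraType (@cvec_cylinder R d)).
Local Notation E f := (Rintegral P setT f).

Lemma measurable_coordinate j :
  complexify (fun f : V -> R => measurable_fun setT f) (fun v => v j 0).
Proof.
split => _ S mS; rewrite setTI; apply: sub_gen_smallest; exists j, S; split => //.
- by left.
- by right.
Qed.

Lemma measurable_haar : measurable_fun [set: T] (psi : T -> V).
Proof. by case: psi_haar => _ mpsi _ _ S mS; rewrite setTI; exact: mpsi. Qed.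

Lemma haar_norm1 t : \sum_j psi t j 0 * (psi t j 0)^* = 1.
Proof.
case: psi_haar => /(_ t)/matrixP/(_ 0 0) + _ _.
rewrite !mxE eqxx mulr1n => <-.
by apply: eq_bigr => j _; rewrite !mxE mulrC.
Qed.

Definition weight (z : R[i]) : R := complex.Re z ^+ 2 + complex.Im z ^+ 2.

Lemma weight_ge0 z : 0 <= weight z.
Proof. by rewrite addr_ge0 ?sqr_ge0. Qed.

Lemma weightE z : z * z^* = (weight z)%:C.
Proof. by rewrite /weight add_Re2_Im2 sqr_normc. Qed.

Lemma haar_weight_sum t : \sum_j weight (psi t j 0) = 1.
Proof.
apply: complexI; rewrite rmorph_sum rmorph1 -(haar_norm1 t).
by apply: eq_bigr => j _; rewrite weightE.
Qed.

Lemma haar_weight_le1 t j : weight (psi t j 0) <= 1.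
Proof.
rewrite -(haar_weight_sum t) (bigD1 j) //= lerDl.
by apply: sumr_ge0 => k _; exact: weight_ge0.
Qed.

Lemma bounded_coordinate j :
  complexify (@bounded_measurable R _ T) (fun t => psi t j 0).
Proof.
have [mRe mIm] := measurable_coordinate j.
have le1 (x y : R) : x ^+ 2 + y ^+ 2 <= 1 -> `|x| <= 1.
  move=> xy; rewrite -(ler_pXn2r (n := 2)) ?nnegrE // real_normK ?num_real //.
  by rewrite expr1n (le_trans _ xy) // lerDl sqr_ge0.
split; split.
- exact: measurableT_comp mRe measurable_haar.
- by exists 1 => t; apply: le1 (haar_weight_le1 t j).
- exact: measurableT_comp mIm measurable_haar.
- by exists 1 => t; apply: le1 (_ : _ + complex.Re (psi t j 0) ^+ 2 <= _);
    rewrite addrC; exact: (haar_weight_le1 t j).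
Qed.

(** Measurability of [F] on vectors makes its preimages Borel sets, to which the invariance of the
    law applies. Boundedness is asked along the two random vectors, because the polynomials [F] are
    not bounded on the whole space. *)
Lemma haar_mean_unitary (U : 'M[R[i]]_d) (F : V -> R) : U \is unitarymx ->
  measurable_fun setT F ->
  bounded_measurable (F \o psi) -> bounded_measurable (fun t => F (U *m psi t)) ->
  E (fun t => F (U *m psi t)) = E (F \o psi).
Proof.
move=> uU mF bF bFU; apply: eq_law_mean => // S mS.
case: psi_haar => _ _ /(_ U uU (F @^-1` S)); apply.
by have := mF measurableT S mS; rewrite setTI.
Qed.

End HaarMoments.

Section DeltaUpdates.
Variables (C : numClosedFieldType) (d : nat).
Implicit Types (v : 'cV[C]_d) (i j : 'I_d).

Lemma delta_col_conj i : (delta_mx i 0 : 'cV[C]_d)^t* = delta_mx 0 i.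
Proof. by rewrite trmx_delta map_delta_mx. Qed.

Lemma delta_row_mul i v : ((delta_mx 0 i : 'rV[C]_d) *m v) 0 0 = v i 0.
Proof. by rewrite -rowE mxE. Qed.

Lemma delta_sub_dot i j v :
  ((delta_mx i 0 - delta_mx j 0 : 'cV[C]_d)^t* *m v) 0 0 = v i 0 - v j 0.
Proof.
by rewrite raddfB /= map_mxB !delta_col_conj mulmxBl -!(delta_row_mul _ v) !mxE.
Qed.

Lemma sign_flip_unitary i : rank_one_update (2 : C) (delta_mx i 0) \is unitarymx.
Proof.
apply: (@rank_one_update_unitary _ _ _ _ 1).
  apply/matrixP => x y; rewrite !ord1 delta_col_conj delta_row_mul !mxE.
  by rewrite !eqxx.
by rewrite conjC_nat; ring.
Qed.

Lemma sign_flipE i v j :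
  (rank_one_update (2 : C) (delta_mx i 0) *m v) j 0 =
  if j == i then - v j 0 else v j 0.
Proof.
rewrite rank_one_updateE delta_col_conj delta_row_mul mxE eqxx andbT.
by case: eqP => [->|_]; rewrite ?mulr0 ?subr0 // mulr1; ring.
Qed.

Lemma pair_mixing_unitary i j (k : C) : i != j -> k + k^* = k * k^* * 2 ->
  rank_one_update k (delta_mx i 0 - delta_mx j 0) \is unitarymx.
Proof.
move=> ij; apply: rank_one_update_unitary.
apply/matrixP => x y; rewrite !ord1 delta_sub_dot !mxE !eqxx !andbT.
by rewrite (negPf ij) eq_sym (negPf ij) /=; ring.
Qed.

Lemma pair_mixingE i j (k : C) v l :
  (rank_one_update k (delta_mx i 0 - delta_mx j 0) *m v) l 0 =
  v l 0 - k * (v i 0 - v j 0) * ((l == i)%:R - (l == j)%:R).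
Proof. by rewrite rank_one_updateE delta_sub_dot !mxE !eqxx !andbT. Qed.

End DeltaUpdates.

(** * Fourth moments of the amplitudes *)

Section HaarMoments4.
Variables (R : realType) (dT : measure_display) (T : measurableType dT).
Variables (P : probability T R) (d : nat) (psi : T -> 'cV[R[i]]_d).
Hypothesis psi_haar : haar_random_state P psi.
Notation V := (g_sigma_algebraType (@cvec_cylinder R d)).
Local Notation E f := (Rintegral P setT f).
Local Notation u j t := (weight (psi t j 0)).

Lemma function_algebra_weight (S : Type) (Q : (S -> R) -> Prop) (f : S -> R[i]) :
  function_algebra Q -> complexify Q f -> Q (fun t => weight (f t)).
Proof.
move=> aQ [fR fI]; rewrite /weight.
by apply: (function_algebraD aQ); exact: (function_algebraX aQ).
Qed.

Lemma bounded_coordinate_mul (U : 'M[R[i]]_d) j :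
  complexify (@bounded_measurable R _ T) (fun t => (U *m psi t) j 0).
Proof.
have aB := complexify_algebra (@bounded_measurable_algebra R _ T).
rewrite (_ : (fun t => _) = fun t => \sum_k U j k * psi t k 0); last first.
  by apply/funext => t; rewrite mxE.
apply: (function_algebra_sum aB) => k.
apply: (function_algebraM aB); first exact: (function_algebra_cst aB).
exact: (bounded_coordinate psi_haar).
Qed.

Lemma bounded_weight j : bounded_measurable (fun t => u j t).
Proof.
apply: function_algebra_weight; first exact: bounded_measurable_algebra.
exact: (bounded_coordinate psi_haar).
Qed.

Lemma bounded_weight_mul j k : bounded_measurable (fun t => u j t * u k t).
Proof.
by apply: (function_algebraM (@bounded_measurable_algebra R _ T)); exact: bounded_weight.
Qed.

(* For [k = (1 - i) / 2] the update along [e_i - e_j] is a square root of the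
   swap of the two amplitudes. *)
Lemma weight_pair_mixing (z z' : R[i]) (k := Complex 2^-1 (- 2^-1)) :
  weight (z - k * (z - z')) ^+ 2 + weight (z' + k * (z - z')) ^+ 2 <=
  2^-1 * (weight z ^+ 2 + weight z' ^+ 2) + 3 * (weight z * weight z').
Proof.
case: z z' => [a b] [c e]; rewrite /weight /k /=.
rewrite -subr_ge0 [leRHS](_ : _ = 2 * (a * c + b * e) ^+ 2).
  by rewrite mulr_ge0 ?sqr_ge0.
by field.
Qed.

(** Mixing leaves the left-hand side S unchanged, while pointwise it gives at most half of the
    original plus three times the product: S <= S / 2 + 3 E[u_i u_j]. *)
Lemma haar_weight_sqr_le i j : i != j ->
  E (fun t => u i t ^+ 2) + E (fun t => u j t ^+ 2) <= 6 * E (fun t => u i t * u j t).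
Proof.
move=> ij; pose k : R[i] := Complex 2^-1 (- 2^-1).
pose U := rank_one_update k (delta_mx i 0 - delta_mx j 0).
pose F (v : V) : R := weight (v i 0) ^+ 2 + weight (v j 0) ^+ 2.
have aB := @bounded_measurable_algebra R _ T.
have uU : U \is unitarymx.
  apply: pair_mixing_unitary => //; apply/eqP; rewrite eq_complex /=.
  by apply/andP; split; apply/eqP; field.
have bQ (S : Type) (Q : (S -> R) -> Prop) (f : S -> 'cV[R[i]]_d) :
    function_algebra Q -> (forall l, complexify Q (fun t => f t l 0)) ->
    Q (fun t => weight (f t i 0) ^+ 2 + weight (f t j 0) ^+ 2).
  move=> aQ Qf; apply: (function_algebraD aQ);
    by apply: (function_algebraX aQ); exact: function_algebra_weight.
have mF : measurable_fun setT F.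
  by apply: bQ; [exact: measurable_algebra|exact: measurable_coordinate].
have bF : bounded_measurable (F \o psi).
  by apply: bQ => //; exact: (bounded_coordinate psi_haar).
have bFU : bounded_measurable (fun t => F (U *m psi t)).
  by apply: bQ => //; exact: bounded_coordinate_mul.
have EF : E (F \o psi) = E (fun t => u i t ^+ 2) + E (fun t => u j t ^+ 2).
  by apply: bounded_meanD; apply: (function_algebraX aB); exact: bounded_weight.
have bR : bounded_measurable (fun t => 3 * (u i t * u j t)).
  apply: (function_algebraM aB) (bounded_weight_mul _ _).
  exact: (function_algebra_cst aB).
have bL : bounded_measurable (fun t => 2^-1 * (F \o psi) t).
  by apply: (function_algebraM aB) => //; exact: (function_algebra_cst aB).
have : E (fun t => F (U *m psi t)) <= E (fun t => 2^-1 * (F \o psi) t + 3 * (u i t * u j t)).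
  apply: bounded_mean_le => //; first exact: (function_algebraD aB).
  move=> t; rewrite /F !pair_mixingE !eqxx (negPf ij) eq_sym (negPf ij).
  rewrite subr0 mulr1 sub0r mulrN1 opprK.
  exact: weight_pair_mixing.
rewrite (haar_mean_unitary psi_haar) // (bounded_meanD P bL bR) (bounded_meanZ P _ bF).
rewrite (bounded_meanZ P _ (bounded_weight_mul i j)) EF.
by move: (E _) (E _) (E _) => x y z; lra.
Qed.

(** Summing the pair bound over ordered pairs counts each second moment 2 (d - 1) times. The
    right-hand side is at most 6, because the products u_i u_j sum to 1 over all pairs. *)
Lemma haar_sum_weight_sqr_le :
  (d%:R - 1) * \sum_i E (fun t => u i t ^+ 2) <= 3.
Proof.
have aB := @bounded_measurable_algebra R _ T.
pose y i := E (fun t => u i t ^+ 2).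
have yd : \sum_i \sum_(j | j != i) (y i + y j) = 2 * ((d%:R - 1) * \sum_i y i).
  have cst (a : R) i : \sum_(j < d | j != i) a = (d%:R - 1) * a.
    rewrite sumr_const cardC1 card_ord -subn1 -[LHS]mulr_natl natrB //.
    by case: i => m; exact: leq_ltn_trans.
  under eq_bigr do rewrite big_split /= cst.
  rewrite big_split /= -mulr_sumr.
  rewrite (exchange_big_dep predT) //=.
  under [X in _ + X]eq_bigr => j _.
    under eq_bigl do rewrite eq_sym.
    rewrite cst; over.
  by rewrite -mulr_sumr mulr_natl mulr2n.
have : \sum_i \sum_(j | j != i) (y i + y j) <=
    6 * \sum_i \sum_(j | j != i) E (fun t => u i t * u j t).
  rewrite mulr_sumr; apply: ler_sum => i _; rewrite mulr_sumr.
  by apply: ler_sum => j ji; apply: haar_weight_sqr_le; rewrite eq_sym.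
have : \sum_i \sum_(j | j != i) E (fun t => u i t * u j t) <= 1.
  rewrite -(mean_cst P 1).
  have <- : E (fun t => \sum_i \sum_j u i t * u j t) = E (fun=> 1).
    apply: eq_Rintegral => t _; under eq_bigr do rewrite -mulr_sumr.
    by rewrite -mulr_suml (haar_weight_sum psi_haar) mulr1.
  rewrite bounded_mean_sum => [|i]; last first.
    by apply: (function_algebra_sum aB) => j; exact: bounded_weight_mul.
  apply: ler_sum => i _; rewrite bounded_mean_sum => [|j]; last exact: bounded_weight_mul.
  rewrite [leRHS](bigD1 i) //= lerDr; apply: Rintegral_ge0 => t _.
  by rewrite mulr_ge0 ?weight_ge0.
rewrite yd /y; lra.
Qed.

(** Amplitude [i] occurs exactly once, so flipping its sign negates the mean while invariance
    preserves it; [j], [k] and [l] may coincide. *)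
Lemma haar_four_point_eq0 i j k l : i != j -> i != k -> i != l ->
  E (fun t => complex.Re (psi t i 0 * (psi t j 0)^* * psi t k 0 * (psi t l 0)^*)) = 0.
Proof.
move=> ij ik il; pose U : 'M[R[i]]_d := rank_one_update 2 (delta_mx i 0).
pose F (v : V) : R := complex.Re (v i 0 * (v j 0)^* * v k 0 * (v l 0)^*).
have bQ (S : Type) (Q : (S -> R) -> Prop) (f : S -> 'cV[R[i]]_d) :
    function_algebra Q -> (forall m, complexify Q (fun t => f t m 0)) ->
    complexify Q (fun t => f t i 0 * (f t j 0)^* * f t k 0 * (f t l 0)^*).
  move=> aQ Qf; have aC := complexify_algebra aQ.
  apply: (function_algebraM aC); last exact: complexify_conj.
  apply: (function_algebraM aC) => //.
  by apply: (function_algebraM aC) => //; exact: complexify_conj.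
have mF : measurable_fun setT F.
  by case: (bQ V _ id (@measurable_algebra R _ V) (@measurable_coordinate R d)).
have bF : bounded_measurable (F \o psi).
  by case: (bQ T _ psi (@bounded_measurable_algebra R _ T) (bounded_coordinate psi_haar)).
have bFU : bounded_measurable (fun t => F (U *m psi t)).
  by case: (bQ T _ _ (@bounded_measurable_algebra R _ T) (bounded_coordinate_mul U)).
have := haar_mean_unitary psi_haar (sign_flip_unitary _ i) mF bF bFU.
have -> : (fun t => F (U *m psi t)) = fun t => -1 * (F \o psi) t.
  apply/funext => t; rewrite /F /U !sign_flipE eqxx.
  rewrite !(eq_sym _ i) (negPf ij) (negPf ik) (negPf il) !mulNr raddfN mul1r.
  by [].
by rewrite bounded_meanZ //= -/(E (F \o psi)); rewrite /F; lra.
Qed.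

End HaarMoments4.

Lemma sum_if_eq (V : nmodType) (J : finType) (j : J) (c : V) :
  \sum_k (if j == k then c else 0) = c.
Proof. by rewrite -big_mkcond (big_pred1 j) // => k; rewrite /= eq_sym. Qed.

Lemma sum_pair_mean (R : numFieldType) (J : finType) (g : J -> R) :
  \sum_j \sum_k 2^-1 * (g j + g k) = #|J|%:R * \sum_j g j.
Proof.
under eq_bigr do rewrite -mulr_sumr big_split /= sumr_const.
rewrite -mulr_sumr big_split /= sumr_const sumrMnl -mulr_natl.
by field.
Qed.

(** * Mean purity of a Haar random state *)

Section HaarPurity.
Variables (R : realType) (dT : measure_display) (T : measurableType dT).
Variables (P : probability T R) (I : finType) (A : {set I}).
Variable psi : T -> 'cV[R[i]]_(qdim I).
Hypothesis psi_haar : haar_random_state P psi.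
Local Notation E f := (Rintegral P setT f).
Notation SA := {ffun {i | i \in A} -> bool}.
Notation SB := {ffun {i | i \in ~: A} -> bool}.
Local Notation u j t := (weight (psi t j 0)).
Local Notation f t := (@amplitude I A R (psi t)).

Let aB := @bounded_measurable_algebra R _ T.
Let aC := complexify_algebra aB.

Lemma bounded_purity_term a a' b b' : complexify (@bounded_measurable R _ T)
  (fun t => f t a b * (f t a' b)^* * f t a' b' * (f t a b')^*).
Proof.
have bf x y : complexify (@bounded_measurable R _ T) (fun t => f t x y).
  exact: (bounded_coordinate psi_haar).
apply: (function_algebraM aC); last exact: complexify_conj.
apply: (function_algebraM aC) => //.
by apply: (function_algebraM aC) => //; exact: complexify_conj.
Qed.

Lemma rpurity_sumE t : rpurity A (psi t) = \sum_a \sum_a' \sum_b \sum_b'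
  complex.Re (f t a b * (f t a' b)^* * f t a' b' * (f t a b')^*).
Proof.
rewrite /rpurity /purity raddf_sum; apply: eq_bigr => a _.
rewrite raddf_sum; apply: eq_bigr => a' _; rewrite raddf_sum.
by apply: eq_bigr => b _; rewrite raddf_sum.
Qed.

Lemma bounded_rpurity : bounded_measurable (fun t => rpurity A (psi t)).
Proof.
rewrite (_ : (fun t => _) = fun t => \sum_a \sum_a' \sum_b \sum_b'
  complex.Re (f t a b * (f t a' b)^* * f t a' b' * (f t a b')^*)); last first.
  by apply/funext => t; exact: rpurity_sumE.
apply: (function_algebra_sum aB) => a; apply: (function_algebra_sum aB) => a'.
apply: (function_algebra_sum aB) => b; apply: (function_algebra_sum aB) => b'.
exact: (bounded_purity_term a a' b b').1.
Qed.

(** If a = a' or b = b', the monomial is a product of two weights, bounded by the mean of their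
    squares; this covers equal and distinct weights alike. Otherwise the mean vanishes. *)
Lemma mean_purity_term_le a a' b b' (y := fun j => E (fun t => u j t ^+ 2)) :
  E (fun t => complex.Re (f t a b * (f t a' b)^* * f t a' b' * (f t a b')^*)) <=
  (if a == a' then 2^-1 * (y (qidx a b) + y (qidx a b')) else 0) +
  (if b == b' then 2^-1 * (y (qidx a b) + y (qidx a' b)) else 0).
Proof.
have y0 j : 0 <= y j by apply: Rintegral_ge0 => t _; exact: sqr_ge0.
have bX j : bounded_measurable (fun t => u j t ^+ 2).
  by apply: (function_algebraX aB); exact: (bounded_weight psi_haar).
have uu i j : E (fun t => u i t * u j t) <= 2^-1 * (y i + y j).
  rewrite -bounded_meanD // -bounded_meanZ; last exact: (function_algebraD aB).
  apply: bounded_mean_le => [||t].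
  - exact: (bounded_weight_mul psi_haar).
  - apply: (function_algebraM aB); first exact: (function_algebra_cst aB).
    exact: (function_algebraD aB).
  - by have := sqr_ge0 (u i t - u j t); lra.
have [<-|aa'] := eqVneq a a'.
  rewrite ler_wpDr //; first by case: ifP => // _; rewrite mulr_ge0 ?addr_ge0.
  apply: le_trans (uu _ _); rewrite le_eqVlt; apply/orP; left; apply/eqP.
  apply: eq_Rintegral => t _; rewrite weightE -mulrA weightE -rmorphM.
  by [].
have [<-|bb'] := eqVneq b b'.
  rewrite add0r; apply: le_trans (uu _ _).
  rewrite le_eqVlt; apply/orP; left; apply/eqP.
  apply: eq_Rintegral => t _; rewrite (_ : _ * _ * _ * _ =
    (f t a b * (f t a b)^*) * (f t a' b * (f t a' b)^*)); last by ring.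
  by rewrite !weightE -rmorphM.
(* With a <> a' and b <> b', the index (a, b) differs from the three other indices. *)
rewrite addr0 le_eqVlt; apply/orP; left; apply/eqP.
apply: (haar_four_point_eq0 psi_haar); rewrite qidx_inj ?(negPf aa') ?andbF //.
by rewrite (negPf bb') andbF.
Qed.

Lemma mean_rpurity_le : (1 < qdim I)%N ->
  E (fun t => rpurity A (psi t)) <= 12 / 2 ^+ minn #|A| #|~: A|.
Proof.
move=> d1; pose y j := E (fun t => u j t ^+ 2).
pose Y := \sum_j y j.
pose dA : R := 2 ^+ #|A|; pose dB : R := 2 ^+ #|~: A|.
have cA : #|{: SA}|%:R = dA by rewrite card_bitstrings natrX.
have cB : #|{: SB}|%:R = dB by rewrite card_bitstrings natrX.
have dAB : (qdim I)%:R = dA * dB by rewrite qdimE natrX -(cardsC A) exprD.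
have YE : Y = \sum_(a : SA) \sum_(b : SB) y (qidx a b) by exact: sum_qidx.
have le1 : E (fun t => rpurity A (psi t)) <= (dA + dB) * Y.
  rewrite (_ : (fun t => _) = fun t => \sum_a \sum_a' \sum_b \sum_b'
    complex.Re (f t a b * (f t a' b)^* * f t a' b' * (f t a b')^*)); last first.
    by apply/funext => t; exact: rpurity_sumE.
  have bT a a' b b' := (bounded_purity_term a a' b b').1.
  rewrite bounded_mean_sum => [|a]; last by do 3!(apply: (function_algebra_sum aB) => ?).
  under eq_bigr => a _.
    rewrite bounded_mean_sum => [|a']; last by do 2!(apply: (function_algebra_sum aB) => ?).
    under eq_bigr => a' _.
      rewrite bounded_mean_sum => [|b]; last by apply: (function_algebra_sum aB) => ?.
      under eq_bigr do rewrite bounded_mean_sum //.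
      over.
    over.
  apply: (@le_trans _ _ (\sum_a \sum_a' \sum_(b : SB) \sum_(b' : SB)
    ((if a == a' then 2^-1 * (y (qidx a b) + y (qidx a b')) else 0) +
     (if b == b' then 2^-1 * (y (qidx a b) + y (qidx a' b)) else 0)))).
    do 4!(apply: ler_sum => ? _); exact: mean_purity_term_le.
  (* The terms with a = a' add up to dB * Y, those with b = b' to dA * Y. *)
  rewrite le_eqVlt; apply/orP; left; apply/eqP.
  rewrite mulrDl addrC; under eq_bigr do under eq_bigr do
    (under eq_bigr do rewrite big_split /=; rewrite big_split /=).
  under eq_bigr do rewrite big_split /=.
  rewrite big_split /=; congr (_ + _).
    under eq_bigr => a _.
      under eq_bigr => a' _.
        rewrite (_ : \sum_b _ = if a == a' then dB * \sum_b y (qidx a b) else 0).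
          over.
        case: eqP => _; first by rewrite sum_pair_mean cB.
        by rewrite big1 // => b _; rewrite big1.
      rewrite sum_if_eq; over.
    by rewrite -mulr_sumr -YE.
  under eq_bigr do under eq_bigr do under eq_bigr do rewrite sum_if_eq.
  under eq_bigr do rewrite exchange_big /=.
  rewrite exchange_big /=; under eq_bigr do rewrite sum_pair_mean cA.
  by rewrite -mulr_sumr YE exchange_big.
have Y0 : 0 <= Y.
  by apply: sumr_ge0 => j _; apply: Rintegral_ge0 => t _; exact: sqr_ge0.
have dA0 : 0 < dA by exact: exprn_gt0.
have dB0 : 0 < dB by exact: exprn_gt0.
have d2 : 2 <= dA * dB by rewrite -dAB ler_nat.
have := haar_sum_weight_sqr_le psi_haar; rewrite dAB -/Y => le2.
(* For dimension d >= 2, d - 1 is at least d / 2, so the bound 3 on (d - 1) Y doubles. The second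
   doubling, to 12, comes from bounding dA^-1 and dB^-1 by the larger one. *)
have le3 : dA * dB * Y <= 6.
  have := ler_wpM2r Y0 d2; lra.
apply: le_trans le1 _; apply: (@le_trans _ _ (6 * (dA^-1 + dB^-1))).
  rewrite (_ : dA^-1 + dB^-1 = (dA + dB) / (dA * dB)); last first.
    by field; rewrite !gt_eqF.
  rewrite mulrA ler_pdivlMr ?mulr_gt0 // -mulrA [leRHS]mulrC.
  by apply: ler_wpM2l; [exact: addr_ge0 (ltW _) (ltW _)|rewrite mulrC].
have inv_le k : (minn #|A| #|~: A| <= k)%N ->
    ((2 : R) ^+ k)^-1 <= (2 ^+ minn #|A| #|~: A|)^-1.
  by move=> mk; rewrite lef_pV2 ?posrE ?exprn_gt0 // ler_weXn2l // ler1n.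
have := inv_le _ (geq_minl _ _); have := inv_le _ (geq_minr _ _).
rewrite -/dA -/dB; lra.
Qed.

End HaarPurity.

(** * Averages of E_4 *)

Section MatrixEntries.
Variables (K : pzRingType) (T : Type) (Q : (T -> K) -> Prop) (d : nat).
Hypothesis algQ : function_algebra Q.
Variable M : T -> 'M[K]_d.
Hypothesis QM : forall i j, Q (fun t => M t i j).

Lemma function_algebra_mxpow k i j : Q (fun t => (M t ^+ k) i j).
Proof.
elim: k i j => [|k IH] i j; first exact: (function_algebra_cst algQ).
rewrite (_ : (fun t => _) = fun t => \sum_l M t i l * (M t ^+ k) l j).
  by apply: (function_algebra_sum algQ) => l; exact: (function_algebraM algQ).
by apply/funext => t; rewrite exprS -mulmxE mxE.
Qed.

Lemma function_algebra_mxtrace_pow k : Q (fun t => \tr (M t ^+ k)).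
Proof.
by apply: (function_algebra_sum algQ) => i; exact: function_algebra_mxpow.
Qed.

End MatrixEntries.

Lemma ln_le_sub1 (R : realType) (x : R) : 0 < x -> ln x <= x - 1.
Proof.
by move=> x0; have := @le_ln1Dx R (x - 1); rewrite subrKC; apply; rewrite ltrBrDr addNr.
Qed.

(* [Y] need not be measurable: the eigenvalues in [trace_norm] are picked by a
   choice operator. *)
Lemma le_expectation_pointwise d (T : measurableType d) (R : realType)
    (P : probability T R) (X Y : T -> R) :
  (forall t, X t <= Y t) -> ('E_P[X] <= 'E_P[Y])%E.
Proof.
move=> XY; rewrite unlock /integral !patch_setT.
have XYE : {in setT, forall t, ((X t)%:E <= (Y t)%:E)%E}.
  by move=> t _; rewrite lee_fin.
(* Each half of the integral is a supremum over simple functions: one lying below the smaller part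
   also lies below the larger, and the negative parts compare in reverse. *)
apply: leeB; apply: le_ereal_sup => _ [h hX <-]; exists h => // t;
  apply: le_trans (hX t) _.
- by apply: (funepos_le XYE); rewrite inE.
- by apply: (funeneg_le XYE); rewrite inE.
Qed.

Section MeanE4.
Variables (R : realType) (dT : measure_display) (T : measurableType dT).
Variables (P : probability T R) (I : finType) (A : {set I}).
Variable psi : T -> 'cV[R[i]]_(qdim I).
Hypothesis psi_haar : haar_random_state P psi.
Local Notation E f := (Rintegral P setT f).
Variable p : R.
Hypotheses (p0 : 0 <= p) (p1 : p < 1).
Hypothesis dim_ge : (2 ^+ #|I|)^-1 <= (1 - p) ^+ 2.
Hypothesis I_gt0 : (0 < #|I|)%N.
Local Notation X := (fun t => pt_E4 (~: A) (depolarized p (psi t))).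
Local Notation m := (minn #|A| #|~: A|).

Let psi1 t : (psi t)^t* *m psi t = 1%:M.
Proof. by case: psi_haar. Qed.

Let aB := @bounded_measurable_algebra R _ T.
Let aC := complexify_algebra aB.

Lemma bounded_pt_moment k :
  bounded_measurable (fun t => pt_moment (~: A) k (depolarized p (psi t))).
Proof.
have bf j : complexify (@bounded_measurable R _ T) (fun t => psi t j 0).
  exact: (bounded_coordinate psi_haar).
(* The moment is the real part of a trace; the complex trace is treated as a whole and its first
   component kept. *)
apply: (proj1 (A := bounded_measurable _)); apply: (function_algebra_mxtrace_pow aC).
move=> i j; rewrite (_ : (fun t => _) = fun t =>
  (1 - p)%:C * (psi t (enum_rank (splice (~: A) (enum_val i) (enum_val j))) 0 *
    (psi t (enum_rank (splice (~: A) (enum_val j) (enum_val i))) 0)^*) +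
  ((p / 2 ^+ #|I|)%:C *: 1%:M : 'M[R[i]]_(qdim I))
    (enum_rank (splice (~: A) (enum_val i) (enum_val j)))
    (enum_rank (splice (~: A) (enum_val j) (enum_val i)))).
  apply: (function_algebraD aC); last exact: (function_algebra_cst aC).
  apply: (function_algebraM aC); first exact: (function_algebra_cst aC).
  by apply: (function_algebraM aC) => //; exact: complexify_conj.
by apply/funext => t; rewrite mxE [LHS]mxE [X in X + _]mxE [X in _ * X]mxE big_ord1 !mxE.
Qed.

Lemma bounded_pt_E4 : bounded_measurable X.
Proof.
split.
  rewrite (_ : (fun t => _) = fun t =>
    2^-1 * (3 * ln (pt_moment (~: A) 2 (depolarized p (psi t))) +
      -1 * ln (pt_moment (~: A) 4 (depolarized p (psi t))))); last first.
    by apply/funext => t; rewrite (pt_E4E A (psi1 t) p0 p1) mulN1r.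
  have aM := @measurable_algebra R _ T.
  have mln k : measurable_fun setT
      (fun t => ln (pt_moment (~: A) k (depolarized p (psi t)))).
    apply: measurableT_comp; first exact: measurable_ln.
    by have [] := bounded_pt_moment k.
  apply: (function_algebraM aM); first exact: (function_algebra_cst aM).
  by apply: (function_algebraD aM); apply: (function_algebraM aM) => //;
    exact: (function_algebra_cst aM).
have [_ [M PM]] := bounded_rpurity A psi_haar.
exists (`|m%:R * ln 2 + (ln 3 / 2 - 2 * ln (1 - p))| +
        `|ln (1 - p) - ln 16 / 2 - M|) => t.
have ub := pt_E4_le A (psi1 t) p0 p1.
have lb := pt_E4_ge A (psi1 t) p0 p1 dim_ge.
have lnP : ln (rpurity A (psi t)) <= M.
  apply: le_trans (ln_le_sub1 (rpurity_gt0 A (psi1 t))) _.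
  by rewrite lerBlDr (le_trans (ler_norm _)) // (le_trans (PM t)) // lerDl.
set K := ln (1 - p) - ln 16 / 2 - M.
rewrite ler_norml; apply/andP; split.
  apply: (@le_trans _ _ (- `|K|)); first by rewrite opprD gerDr oppr_le0.
  apply: (@le_trans _ _ K); first by rewrite lerNl -normrN ler_norm.
  by apply: le_trans lb; rewrite /K lerD2l lerN2.
by apply: le_trans ub _; apply: le_trans (ler_norm _) _; rewrite lerDl.
Qed.

Lemma mean_pt_E4_le : E X <= m%:R * ln 2 + (ln 3 / 2 - 2 * ln (1 - p)).
Proof.
rewrite -[leRHS](mean_cst P); apply: bounded_mean_le; first exact: bounded_pt_E4.
  exact: (function_algebra_cst aB).
by move=> t; exact: pt_E4_le.
Qed.

(** The logarithm is replaced by its tangent at 2^-m, the order of magnitude of E[P]: ln P <= 2^m P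
    - 1 - m ln 2. Since 2^m E[P] <= 12, the averaged error is 12 - 1 = 11. *)
Lemma mean_pt_E4_ge : m%:R * ln 2 + ln (1 - p) - (ln 16 / 2 + 11) <= E X.
Proof.
pose K := m%:R * ln 2 + ln (1 - p) - ln 16 / 2 + 1.
have bL : bounded_measurable (fun t => K + - 2 ^+ m * rpurity A (psi t)).
  apply: (function_algebraD aB); first exact: (function_algebra_cst aB).
  apply: (function_algebraM aB); first exact: (function_algebra_cst aB).
  exact: (bounded_rpurity A psi_haar).
have : E (fun t => K + - 2 ^+ m * rpurity A (psi t)) <= E X.
  apply: bounded_mean_le => // [|t]; first exact: bounded_pt_E4.
  have := pt_E4_ge A (psi1 t) p0 p1 dim_ge; apply: le_trans.
  have Pt0 := rpurity_gt0 A (psi1 t).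
  have : ln (2 ^+ m * rpurity A (psi t)) <= 2 ^+ m * rpurity A (psi t) - 1.
    by apply: ln_le_sub1; rewrite mulr_gt0 // exprn_gt0.
  rewrite lnM ?posrE ?exprn_gt0 // lnXn // -[ln 2 *+ _]mulr_natl /K mulNr. lra.
apply: le_trans.
rewrite bounded_meanD ?mean_cst ?bounded_meanZ; last 3 first.
- exact: (bounded_rpurity A psi_haar).
- exact: (function_algebra_cst aB).
- apply: (function_algebraM aB); first exact: (function_algebra_cst aB).
  exact: (bounded_rpurity A psi_haar).
have d1 : (1 < qdim I)%N by rewrite qdimE -[1%N](expn0 2) ltn_exp2l.
have := mean_rpurity_le A psi_haar d1.
rewrite ler_pdivlMr ?exprn_gt0 // mulrC /K mulNr; lra.
Qed.

Lemma expectation_pt_E4 : ('E_P[X] = (E X)%:E)%E.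
Proof. exact/bounded_mean_expectation/bounded_pt_E4. Qed.

Lemma expectation_negativity_ge :
  ('E_P[X] <= 'E_P[fun t => pt_negativity (~: A) (depolarized p (psi t))])%E.
Proof. by apply: le_expectation_pointwise => t; exact: pt_E4_le_negativity. Qed.

End MeanE4.

(** * Leading order *)

Section Asymptotics.
Variable R : realType.

Lemma bounded_littleo_natr (e : nat -> R^o) (C : R) :
  (\forall n \near \oo, `|e n| <= C) -> e =o_\oo (fun n => n%:R : R^o).
Proof.
move=> eC; apply/eqoP => eps eps0; near=> n.
apply: (@le_trans _ _ C); first by near: n.
rewrite ger0_norm // mulrC -ler_pdivrMr //.
by near: n; exact: nbhs_infty_ger.
Unshelve. all: by end_near. Qed.

Lemma inv_exp2_le_near (x : R) : 0 < x -> \forall n \near \oo, (2 ^+ n)^-1 <= x.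
Proof.
move=> x0; near=> n.
rewrite invf_ple ?posrE ?exprn_gt0 //; apply: (@le_trans _ _ n%:R).
  by near: n; exact: nbhs_infty_ger.
by rewrite -natrX ler_nat ltnW // ltn_expl.
Unshelve. all: by end_near. Qed.

Lemma leading_eq_bounded (u : nat -> \bar R) (f v : nat -> R) (C : R) :
  (\forall n \near \oo, u n = (f n)%:E /\ `|f n - v n| <= C) -> leading_eq u v.
Proof.
move=> H; exists (fun n => f n - v n).
  by apply: (@bounded_littleo_natr _ C); apply: filterS H => n [].
by apply: filterS H => n [-> _]; rewrite addrC subrK.
Qed.

Lemma leading_ge_bounded (u : nat -> \bar R) (v : nat -> R) (C : R) :
  (\forall n \near \oo, ((v n - C)%:E <= u n)%E) -> leading_ge u v.
Proof.
move=> H; exists (fun=> - C) => //.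
by apply: (@bounded_littleo_natr _ `|C|); near=> n; rewrite normrN.
Unshelve. all: by end_near. Qed.

Lemma minn_extensive (A : forall n, {set 'I_n}) (a g : R) :
  (#|A n|%:R / n%:R : R) @[n --> \oo] --> a -> g < Num.min a (1 - a) ->
  \forall n \near \oo, g * n%:R <= (minn #|A n| #|~: A n|)%:R.
Proof.
move=> Aa; rewrite lt_min => /andP[ga g1a]; near=> n.
have n0 : (0 < n)%N by near: n; exact: nbhs_infty_gt.
have n0R : 0 < n%:R :> R by rewrite ltr0n.
have lb : g < #|A n|%:R / n%:R by near: n; exact: cvgr_gt Aa _ ga.
have ub : #|A n|%:R / n%:R < 1 - g.
  by near: n; apply: cvgr_lt Aa _ _; lra.
have cC : #|A n|%:R + #|~: A n|%:R = n%:R :> R by rewrite -natrD cardsC card_ord.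
have lA : g * n%:R <= #|A n|%:R by rewrite -ler_pdivlMr // ltW.
have lB : g * n%:R <= #|~: A n|%:R.
  by move: ub; rewrite ltr_pdivrMr // => /ltW; lra.
by rewrite /minn; case: ifP.
Unshelve. all: by end_near. Qed.

Lemma linear_growth_near (g K : R) : 0 < g ->
  \forall n \near \oo, g / 2 * n%:R <= g * n%:R - K.
Proof.
move=> g0; near=> n.
have : K / (g / 2) <= n%:R by near: n; exact: nbhs_infty_ger.
by rewrite ler_pdivrMr ?divr_gt0 //; lra.
Unshelve. all: by end_near. Qed.

End Asymptotics.

Theorem mainTheorem14 (R : realType)
    (dT : nat -> measure_display) (T : forall n, measurableType (dT n))
    (P : forall n, probability (T n) R)
    (psi : forall n, T n -> 'cV[R[i]]_(qdim 'I_n))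
    (psi_haar : forall n, haar_random_state (P n) (psi n))
    (A : forall n, {set 'I_n}) (a : R) (a_gt0 : 0 < a) (a_lt1 : a < 1)
    (A_extensive : (#|A n|%:R / n%:R : R) @[n --> \oo] --> a) :
  (forall p : R, 0 <= p -> p < 1 ->
     leading_eq
       (fun n => 'E_(P n)[fun t => pt_E4 (~: A n) (depolarized p (psi n t))])%E
       (fun n => (minn #|A n| #|~: A n|)%:R * ln 2))
  /\
  (forall beta : R, 0 < beta -> beta <= 2^-1 ->
     let p n : R := 1 - 2 `^ (- (beta * n%:R)) in
     leading_ge
       (fun n => 'E_(P n)[fun t => pt_E4 (~: A n) (depolarized (p n) (psi n t))])%E
       (fun n => (minn #|A n| #|~: A n|)%:R * ln 2 - beta * n%:R * ln 2)
     /\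
     (beta < Num.min a (1 - a) ->
        (\forall n \near \oo,
           (0 < 'E_(P n)[fun t => pt_E4 (~: A n) (depolarized (p n) (psi n t))])%E)
        /\
        (exists2 c : R, 0 < c & \forall n \near \oo,
           ((c * n%:R)%:E <=
            'E_(P n)[fun t =>
               pt_negativity (~: A n) (depolarized (p n) (psi n t))])%E))).
Proof.
split=> [p p0 p1|beta beta_gt0 beta_le p].
  have q0 : 0 < (1 - p) ^+ 2 by rewrite exprn_gt0 // subr_gt0.
  pose C := `|ln 3 / 2 - 2 * ln (1 - p)| + `|ln (1 - p) - (ln 16 / 2 + 11)|.
  apply: (@leading_eq_bounded _ _ (fun n => Rintegral (P n) setT
    (fun t => pt_E4 (~: A n) (depolarized p (psi n t)))) _ C).
  near=> n.
  have n0 : (0 < #|'I_n|)%N by rewrite card_ord; near: n; exact: nbhs_infty_gt.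
  have Dq : (2 ^+ #|'I_n|)^-1 <= (1 - p) ^+ 2.
    by rewrite card_ord; near: n; exact: inv_exp2_le_near.
  split; first exact: (expectation_pt_E4 (A n) (psi_haar n) p0 p1 Dq).
  have ub := mean_pt_E4_le (A n) (psi_haar n) p0 p1 Dq.
  have lb := mean_pt_E4_ge (A n) (psi_haar n) p0 p1 Dq n0.
  move: ub lb; rewrite /C; move: (Rintegral _ _ _) (ln 3 / _ - _) (ln 16 / 2 + 11).
  move=> f x y fx fy; have := ler_norm x; have := ler_norm (- (ln (1 - p) - y)).
  have := normr_ge0 x; have := normr_ge0 (ln (1 - p) - y).
  by rewrite normrN ler_norml => *; apply/andP; split; lra.
pose q n : R := 2 `^ (- (beta * n%:R)).
have qE n : 1 - p n = q n by rewrite /p subKr.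
have q_gt0 n : 0 < q n by exact: powR_gt0.
have ln_q n : ln (q n) = - (beta * n%:R * ln 2) by rewrite ln_powR mulNr.
have q_le1 n : q n <= 1.
  by rewrite /q -[leRHS](powRr0 2) ler_powR ?ler1n // oppr_le0 mulr_ge0 // ltW.
have p0 n : 0 <= p n by rewrite subr_ge0 q_le1.
have p1 n : p n < 1 by rewrite ltrBlDr ltrDl q_gt0.
(* After taking logarithms this reads 2 beta <= 1, which is where the upper bound on [beta]
   enters. *)
have Dq n : (2 ^+ #|'I_n|)^-1 <= (1 - p n) ^+ 2.
  rewrite qE card_ord -ler_ln ?posrE ?invr_gt0 ?exprn_gt0 //.
  rewrite lnV ?posrE ?exprn_gt0 // !lnXn // ln_q -[ln 2 *+ n]mulr_natl.
  have l2 : 0 <= n%:R * ln 2 :> R by rewrite mulr_ge0 // ln_ge0 // ler1n.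
  have := ler_wpM2r l2 beta_le; rewrite -[_ *+ 2]mulr_natr; lra.
have Elb : \forall n \near \oo,
    (((minn #|A n| #|~: A n|)%:R * ln 2 - beta * n%:R * ln 2 - (ln 16 / 2 + 11))%:E
      <= 'E_(P n)[fun t => pt_E4 (~: A n) (depolarized (p n) (psi n t))])%E.
  near=> n.
  have n0 : (0 < #|'I_n|)%N by rewrite card_ord; near: n; exact: nbhs_infty_gt.
  rewrite (expectation_pt_E4 (A n) (psi_haar n) (p0 n) (p1 n) (Dq n)) lee_fin.
  have := mean_pt_E4_ge (A n) (psi_haar n) (p0 n) (p1 n) (Dq n) n0.
  by rewrite qE ln_q.
split; first exact: leading_ge_bounded Elb.
move=> beta_lt; set mu := Num.min a (1 - a) in beta_lt.
(* As min(n_A, n_B) / n tends to [mu], it eventually exceeds the midpoint of [beta] and [mu], which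
   lies (mu - beta) / 2 above [beta]. Half of the resulting slope [g] survives once the additive
   constant is absorbed. *)
pose g := (mu - beta) / 2 * ln 2.
have ln2 : 0 < ln 2 :> R by rewrite ln_gt0 // ltr1n.
have g0 : 0 < g by rewrite mulr_gt0 // divr_gt0 // subr_gt0.
have gE : (beta + mu) / 2 < mu by lra.
have linear : \forall n \near \oo, ((g / 2 * n%:R)%:E <=
    'E_(P n)[fun t => pt_E4 (~: A n) (depolarized (p n) (psi n t))])%E.
  near=> n; apply: (@le_trans _ _ ((minn #|A n| #|~: A n|)%:R * ln 2 -
    beta * n%:R * ln 2 - (ln 16 / 2 + 11))%:E); last by near: n.
  rewrite lee_fin; apply: (@le_trans _ _ (g * n%:R - (ln 16 / 2 + 11))).
    by near: n; exact: linear_growth_near.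
  rewrite lerD2r -mulrBl /g [leLHS]mulrAC ler_pM2r // lerBrDl.
  have : (beta + mu) / 2 * n%:R <= (minn #|A n| #|~: A n|)%:R.
    by near: n; exact: minn_extensive A_extensive gE.
  lra.
split.
  near=> n; apply: lt_le_trans (_ : ((g / 2 * n%:R)%:E <= _)%E); last by near: n.
  rewrite lte_fin mulr_gt0 ?divr_gt0 // ltr0n.
  by near: n; exact: nbhs_infty_gt.
exists (g / 2); first by rewrite divr_gt0.
near=> n; apply: le_trans (_ : ('E_(P n)[fun t => pt_E4 (~: A n) (depolarized (p n) (psi n t))] <= _)%E); first by near: n.
exact: (expectation_negativity_ge (A n) (psi_haar n) (p0 n) (p1 n)).
Unshelve. all: by end_near. Qed.
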